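(* For every $a\in(0,1)$ and every $m\in\mathbb{N}$, $$L^m_m(a)=L^0_m\left(\frac{2\sqrt a}{1+a}\right),$$ and consequently, for every $a\in(0,1)$, $$\lim_{m\to\infty}L^m_m(a)\left(\frac{1+\sqrt a}{1-\sqrt a}\right)^{2m-1}(2m-1)^{\frac12}=\frac{1-a}{\sqrt{\pi\sqrt a\,(1+a)}}.$$
   Context: $\mathbb{N}=\{1,2,\dots\}$. For $k,m\in\mathbb{N}$ and $a\in(0,1)$, $L^k_m(a)=\inf_f\sup_{|x|\in[a,1]}|\operatorname{sgn}(x)-f(x)|$, where $f$ ranges over all functions $f(x)=\sum_{j=-(2k-1)}^{2m-1}a_jx^j$ with real coefficients. For $k=0$, $L^0_m(b)$, $b\in(0,1)$, denotes the error of the best uniform approximation of $\operatorname{sgn}(x)$ on $[-1,-b]\cup[b,1]$ by polynomials of degree at most $2m-1$. *)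

(* Defs.v *)
From mathcomp Require Import all_boot all_order all_algebra.
From mathcomp Require Import all_classical all_reals all_analysis.

Set Implicit Arguments.
Unset Strict Implicit.
Unset Printing Implicit Defensive.

Import Order.TTheory GRing.Theory Num.Theory.
Import numFieldNormedType.Exports.

Local Open Scope classical_set_scope.
Local Open Scope ring_scope.

(* sum_{j = -(2k-1)}^{2m-1} c_j x^j for k, m >= 1: the index j is
   i - (2k-1), and there are 2k + 2m - 1 terms. *)
Definition laurent_sum (R : realType) (k m : nat) (c : int -> R) (x : R) : R :=
  \sum_(i < (2 * k + 2 * m).-1)
    c (i%:Z - (2 * k%:Z - 1)) * x ^ (i%:Z - (2 * k%:Z - 1)).

(* The case k = 0 has its own convention: all polynomials of degree at most
   2m - 1, constant term included. *)
Definition approximants (R : realType) (k m : nat) : set (R -> R) :=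
  if k is 0%N then
    [set f | exists p : {poly R}, (size p <= 2 * m)%N /\ f = fun x => p.[x]]
  else
    [set f | exists c : int -> R, f = laurent_sum k m c].

(* [sup] is the real-valued supremum.  For 0 < a < 1 and f in [approximants],
   f is continuous on the nonempty compact set a <= |x| <= 1, so the set of
   values is nonempty and bounded and the default value of [sup] is not used. *)
Definition sgn_dist (R : realType) (a : R) (f : R -> R) : R :=
  sup [set `|Num.sg x - f x| | x in [set x : R | a <= `|x| <= 1]].

Definition sgn_error (R : realType) (k m : nat) (a : R) : R :=
  inf [set sgn_dist a f | f in @approximants R k m].

(* Main.v *)
Require Import Defs.
From mathcomp Require Import all_boot all_order all_algebra.
From mathcomp Require Import all_classical all_reals all_analysis.
From mathcomp Require Import measurable_realfun.
From mathcomp Require Import zify ring lra.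

Import Order.TTheory GRing.Theory Num.Theory.
Import numFieldNormedType.Exports.

Set Implicit Arguments.
Unset Strict Implicit.
Unset Printing Implicit Defensive.

Local Open Scope classical_set_scope.
Local Open Scope ring_scope.

(** Write L0_m(b) for the error of best approximation by polynomials of degree
    at most 2m-1.

    The identity.  With b = 2 sqrt a / (1 + a), the map
    x |-> t = (x + a/x) / (1 + a) folds [a,1] twice onto [b,1] and commutes with
    x |-> -x, so it preserves signs.  A polynomial of degree at most 2m-1 in t is
    a Laurent sum in x of the required shape, with the same error.  Conversely,
    averaging a Laurent sum over x and a/x does not increase its error, and the
    average of x^j is, up to a scalar, a Dickson polynomial in t, of degree |j|
    ([sgn_error_joukowski]).

    The limit.  It remains to find the asymptotics of L0_(n+1)(b), which is done
    by exhibiting nearly optimal polynomials.  Put d = 2n+1 and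
    r = (1-b)/(1+b), and parametrize [b,1] by
    x^2 = (1+b^2)/2 - (1-b^2)/2 cos w, w in [0,pi].  Let V_n be the
    Chebyshev-type polynomial of degree n in y with
    sin w * V_n(x^2) = sin((n+1)w) - r sin(nw) =: S(w), and let
    W(x) be the integral of V_n(t^2) over [0,x], an odd polynomial of degree 2n+1.
    With C(w) = cos((n+1)w) - r cos(nw), the complex number C + iS has modulus
    2x/(1+b), and its argument grows at the rate (d + b/x^2)/2.  Hence one
    integration by parts gives, on [b,1],

      W(x) = u + B(w) + O(1/d^2),   B = - (1-b^2)/2 * C x / (d x^2 + b),

    with u independent of x ([is_derive_residual], [residual_cst]).  The
    boundary term B is at most (1-b)/d in absolute value, and at the n+2 zeros of
    S it has alternating signs and absolute value at least (1-b)/(d + 1/b).  So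
    W/u approximates sgn with an error (1-b)/(d |u|) up to lower order
    ([sgn_error_upper]), and by the alternation argument of de la Vallee Poussin
    nothing does better to leading order ([sgn_error_lower]).  Therefore
    d |u| L0_(n+1)(b) tends to 1-b.

    The constant u differs from W(b) by O(1/d), and W(b) grows exponentially.
    On [0,b] the polynomial tau(x^2) that equals 2 cos w on [b,1] is at least 2,
    and V_n behaves like zeta^n, where zeta + 1/zeta = tau and zeta >= 1; the
    maximum of zeta is 1/r, at t = 0, and r^n V_n(s^2/d) tends to
    exp(-s^2/(2b)).  Laplace's method, in the form of dominated convergence
    against a normal density, yields r^n sqrt d W(b) --> sqrt(2 pi b)/2
    ([cvg_odd_primitive]).  Dividing the two limits gives [cvg_sgn_error0], and
    the theorem follows from 1/r = ((1 + sqrt a)/(1 - sqrt a))^2. *)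

(** * The error as a supremum and an infimum *)

Section SgnDist.
Variable R : realType.
Implicit Types (a M x : R) (f : R -> R) (k m : nat).

Lemma sgn_dist_le a M f : a <= 1 ->
  (forall x, a <= `|x| <= 1 -> `|Num.sg x - f x| <= M) -> sgn_dist a f <= M.
Proof.
move=> a1 H; apply: ge_sup; last by move=> _ [x /= hx <-]; exact: H.
by exists `|Num.sg 1 - f 1|, 1 => //=; rewrite normr1 a1 lexx.
Qed.

(** The bound on f makes the set of errors bounded above, so that [sup] is a
    genuine supremum. *)
Lemma le_sgn_dist a M f x :
  (forall y, a <= `|y| <= 1 -> `|f y| <= M) ->
  a <= `|x| <= 1 -> `|Num.sg x - f x| <= sgn_dist a f.
Proof.
move=> H hx; apply: ub_le_sup; last by exists x.
exists (1 + M) => _ [y /= hy <-].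
apply: le_trans (ler_normB _ _) _; apply: lerD; last exact: H.
by rewrite normr_sg; case: (y != 0).
Qed.

Lemma sgn_dist_ge0 a f : 0 <= sgn_dist a f.
Proof.
rewrite /sgn_dist; set E := [set _ | _ in _].
have [[E0 ubE]|/sup_out->//] := pselect (has_sup E).
have [y Ey] := E0; apply: le_trans (ub_le_sup ubE Ey).
by case: Ey => x _ <-.
Qed.

Lemma approximants_neq0 k m : exists f, @approximants R k m f.
Proof.
case: k => [|k]; first by exists (fun x => (0 : {poly R}).[x]), 0; rewrite size_poly0.
by exists (laurent_sum k.+1 m (fun=> 0)), (fun=> 0).
Qed.

Lemma sgn_error_le a k m f : approximants k m f -> sgn_error k m a <= sgn_dist a f.
Proof.
move=> hf; apply: ge_inf; last by exists f.
by exists 0 => _ [g _ <-]; exact: sgn_dist_ge0.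
Qed.

Lemma le_sgn_error a k m M :
  (forall f, approximants k m f -> M <= sgn_dist a f) -> M <= sgn_error k m a.
Proof.
move=> H; apply: lb_le_inf => [|_ [f hf <-]]; last exact: H.
by have [f hf] := approximants_neq0 k m; exists (sgn_dist a f), f.
Qed.

Lemma norm_exprz_le a x (j : int) : 0 < a -> a <= `|x| <= 1 ->
  `|x ^ j| <= a^-1 ^+ `|j|%N.
Proof.
move=> a0 /andP[ax x1].
have x0 : 0 < `|x| := lt_le_trans a0 ax.
have a1 : 1 <= a^-1 by rewrite invf_ge1 // (le_trans ax).
case: j => n; rewrite /exprz ?NegzE ?normrV ?unitfE ?expf_neq0 -?normr_gt0 // ?normrX /=.
  by rewrite (le_trans (exprn_ile1 _ (ltW x0) x1)) // exprn_ege1.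
rewrite -exprVn; apply: lerXn2r; rewrite ?nnegrE ?invr_ge0 ?(ltW a0) ?(ltW x0) //.
by rewrite lef_pV2.
Qed.

Lemma approximants_bounded a k m f : 0 < a -> approximants k m f ->
  exists M, forall x, a <= `|x| <= 1 -> `|f x| <= M.
Proof.
case: k => [|k] a0.
  case=> p [_ ->]; exists (\sum_(i < size p) `|p`_i|) => x /andP[_ x1].
  rewrite horner_coef; apply: le_trans (ler_norm_sum _ _ _) _.
  apply: ler_sum => i _; rewrite normrM normrX ler_piMr //.
  exact: exprn_ile1.
case=> c ->.
exists (\sum_(i < (2 * k.+1 + 2 * m).-1)
  `|c (i%:Z - (2 * k.+1%:Z - 1))| * a^-1 ^+ `|(i%:Z - (2 * k.+1%:Z - 1))%R|%N) => x hx.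
apply: le_trans (ler_norm_sum _ _ _) _; apply: ler_sum => i _.
by rewrite normrM ler_wpM2l //; exact: norm_exprz_le.
Qed.

Lemma approximants_le_sgn_dist a k m f x : 0 < a -> approximants k m f ->
  a <= `|x| <= 1 -> `|Num.sg x - f x| <= sgn_dist a f.
Proof.
by move=> a0 /(approximants_bounded a0)[M hM]; exact: (le_sgn_dist hM).
Qed.

End SgnDist.

(** * The substitution t = (x + a/x) / (1 + a) *)

Section Laurent.
Variable R : realType.
Implicit Types (a x : R) (g h : R -> R) (m : nat).

(** Agreement is required away from 0 only: under the convention 0^-1 = 0 the
    substitution fails at 0, which is outside the domain of approximation. *)
Definition is_laurent m g :=
  exists c, forall x, x != 0 -> g x = laurent_sum m m c x.

Lemma is_laurentD m g h : is_laurent m g -> is_laurent m h ->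
  is_laurent m (fun x => g x + h x).
Proof.
move=> [c hc] [e he]; exists (fun j => c j + e j) => x x0.
rewrite hc // he // /laurent_sum -big_split; apply: eq_bigr => i _.
by rewrite [RHS]mulrDl.
Qed.

Lemma is_laurentZ m g (k : R) : is_laurent m g -> is_laurent m (fun x => k * g x).
Proof.
move=> [c hc]; exists (fun j => k * c j) => x x0.
by rewrite hc // /laurent_sum big_distrr; apply: eq_bigr => i _ /=; rewrite mulrA.
Qed.

Lemma is_laurent_sum m n (g : nat -> R -> R) :
  (forall i, (i < n)%N -> is_laurent m (g i)) ->
  is_laurent m (fun x => \sum_(i < n) g i x).
Proof.
elim: n => [_|n IH H].
  exists (fun=> 0) => x _; rewrite big_ord0 /laurent_sum big1 // => i _.
  by rewrite mul0r.
have [c hc] := is_laurentD (IH (fun i hi => H i (ltnW hi))) (H n (ltnSn n)).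
by exists c => x x0; rewrite big_ord_recr /= hc.
Qed.

Lemma is_laurent_exprz m (j : int) : (`|j| < 2 * m)%N ->
  is_laurent m (fun x => x ^ j).
Proof.
move=> jm; exists (fun i => (i == j)%:R) => x _; rewrite /laurent_sum.
have hj : (`|(j + (2 * m%:Z - 1))%R| < (2 * m + 2 * m).-1)%N by lia.
have ej : `|(j + (2 * m%:Z - 1))%R|%N%:Z - (2 * m%:Z - 1) = j by lia.
rewrite (bigD1 (Ordinal hj)) //= ej eqxx mul1r big1 ?addr0 // => i /negP ni.
rewrite (_ : _ == j = false) ?mul0r //; apply/negP => /eqP ij; apply: ni.
by apply/eqP/val_inj => /=; lia.
Qed.

(** By the binomial formula, (x + a/x)^j is a combination of the x^(j - 2i),
    0 <= i <= j, and |j - 2i| <= j <= 2m - 1. *)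
Lemma is_laurent_horner_joukowski a m (p : {poly R}) : (size p <= 2 * m)%N ->
  is_laurent m (fun x => p.[(x + a / x) / (1 + a)]).
Proof.
move=> sp.
have H := @is_laurent_sum m (size p)
  (fun j x => p`_j * ((1 + a) ^- j * \sum_(i < j.+1) a ^+ i * 'C(j, i)%:R * x ^ (j%:Z - 2 * i%:Z))).
case: H => [j jp|c hc].
  apply/is_laurentZ/is_laurentZ.
  apply: (@is_laurent_sum m j.+1 (fun i x => a ^+ i * 'C(j, i)%:R * x ^ (j%:Z - 2 * i%:Z))).
  move=> i ij; apply: is_laurentZ; apply: is_laurent_exprz.
  by lia.
exists c => x x0; rewrite -hc // horner_coef; apply: eq_bigr => j _; congr (_ * _).
rewrite exprMn exprVn mulrC; congr (_ * _).
rewrite exprDn; apply: eq_bigr => i _.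
have ij : (i <= j)%N by rewrite -ltnS.
rewrite -mulr_natr exprMn (_ : j%:Z - 2 * i%:Z = (j - i)%N%:Z - i%:Z); last lia.
by rewrite expfzDr // exprVn; rewrite /exprz; case: (i : nat) => [|n] /=; rewrite ?expr0 ?invr1 ?oppr0; ring.
Qed.

(** The recurrence D_(j+2) = s D_(j+1) - a D_j, where s = x + a/x, together with
    s = (1 + a) t. *)
Lemma dickson_poly a j : 0 < a -> exists p : {poly R}, (size p <= j.+1)%N /\
  forall x, x != 0 -> p.[(x + a / x) / (1 + a)] = x ^+ j + (a / x) ^+ j.
Proof.
move=> a0.
have a1 : 1 + a != 0 by rewrite gt_eqF // addr_gt0.
suff [p [q [sp [sq H]]]] : exists p q : {poly R},
    (size p <= j.+1)%N /\ (size q <= j.+2)%N /\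
    forall x, x != 0 -> p.[(x + a / x) / (1 + a)] = x ^+ j + (a / x) ^+ j /\
      q.[(x + a / x) / (1 + a)] = x ^+ j.+1 + (a / x) ^+ j.+1.
  by exists p; split=> // x /H[].
elim: j => [|j [p [q [sp [sq H]]]]].
  exists 2%:P, ((1 + a) *: 'X); split; first exact: size_polyC_leq1.
  split; first by rewrite (leq_trans (size_scale_leq _ _)) // size_polyX.
  move=> x x0; rewrite !hornerE !expr0 !expr1; split; first by [].
  by rewrite [LHS]mulrC mulKf.
exists q, ((1 + a) *: ('X * q) - a *: p); split=> //; split.
  rewrite (leq_trans (size_polyD _ _)) // geq_max size_polyN.
  rewrite !(leq_trans (size_scale_leq _ _)) //.
    by rewrite (leq_trans sp) // ltnW.
  by rewrite (leq_trans (size_polyMleq _ _)) // size_polyX.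
move=> x x0; have [hp hq] := H x x0; split=> //.
rewrite hornerD hornerN !hornerZ hornerM hornerX hp hq !exprS.
move: (x ^+ j) ((a / x) ^+ j) => X Y.
by field; rewrite a1 x0.
Qed.

(** A negative power is reduced to a positive one by
    x^-k + (a/x)^-k = a^-k ((a/x)^k + x^k). *)
Lemma laurent_average_poly a m (c : int -> R) : 0 < a -> (0 < m)%N ->
  exists p : {poly R}, (size p <= 2 * m)%N /\ forall x, x != 0 ->
    p.[(x + a / x) / (1 + a)] = (laurent_sum m m c x + laurent_sum m m c (a / x)) / 2.
Proof.
move=> a0 m0.
have D (j : int) : (`|j| < 2 * m)%N -> exists p : {poly R}, (size p <= 2 * m)%N /\
    forall x, x != 0 -> p.[(x + a / x) / (1 + a)] = x ^ j + (a / x) ^ j.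
  move=> jm; have [p [sp hp]] := @dickson_poly a `|j|%N a0.
  have sp' : (size p <= 2 * m)%N := leq_trans sp jm.
  case: j jm p sp hp sp' => n /= jm p sp hp sp'; first by exists p.
  exists (a ^- n.+1 *: p); split; first by rewrite (leq_trans (size_scale_leq _ _)).
  move=> x x0; rewrite hornerZ hp // /exprz.
  have an : a ^+ n.+1 != 0 by rewrite expf_neq0 // gt_eqF.
  have xn : x ^+ n.+1 != 0 by rewrite expf_neq0.
  by rewrite !exprMn exprVn; field; rewrite an xn.
rewrite /laurent_sum; set N := _.-1.
have : (N <= (2 * m + 2 * m).-1)%N by [].
elim: N => [_|N IH hN].
  by exists 0; rewrite size_poly0; split=> // x _; rewrite !big_ord0 horner0 addr0 mul0r.
have [p [sp hp]] := IH (ltnW hN).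
have [|q [sq hq]] := D (N%:Z - (2 * m%:Z - 1)); first by lia.
exists (p + (c (N%:Z - (2 * m%:Z - 1)) / 2) *: q); split.
  rewrite (leq_trans (size_polyD _ _)) // geq_max sp.
  by rewrite (leq_trans (size_scale_leq _ _)).
move=> x x0; rewrite hornerD hornerZ hp // hq // !big_ord_recr /=.
by set u := \sum_(i < N) _; set v := \sum_(i < N) _; field.
Qed.

(** The preimage is the larger root of x^2 - s x + a = 0, where s = (1 + a) t. *)
Lemma joukowski_onto a t : 0 < a -> a < 1 -> 2 * Num.sqrt a / (1 + a) <= t <= 1 ->
  exists2 x, a <= x <= 1 & (x + a / x) / (1 + a) = t.
Proof.
move=> a0 a1 /andP[bt t1].
have s0 : 0 < Num.sqrt a by rewrite sqrtr_gt0.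
have sa : Num.sqrt a ^+ 2 = a by rewrite sqr_sqrtr // ltW.
set s := (1 + a) * t.
have p1 : 0 < 1 + a by lra.
have sl : 2 * Num.sqrt a <= s by move: bt; rewrite ler_pdivrMr // mulrC (mulrC t) /s; lra.
have su : s <= 1 + a by rewrite /s ger_pMr.
have D0 : 0 <= s ^+ 2 - 4 * a by nra.
set D := Num.sqrt (s ^+ 2 - 4 * a).
have hD : D ^+ 2 = s ^+ 2 - 4 * a by rewrite sqr_sqrtr.
have D00 : 0 <= D by exact: sqrtr_ge0.
have x0 : 0 < (s + D) / 2 by lra.
exists ((s + D) / 2).
  have : D <= 2 - s by rewrite -ler_sqr ?nnegrE; nra.
  move=> H; apply/andP; split; nra.
have ax : a / ((s + D) / 2) = (s - D) / 2.
  apply: (mulIf (lt0r_neq0 x0)); rewrite divfK ?lt0r_neq0 //.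
  have -> : a = (s ^+ 2 - D ^+ 2) / 4 by lra.
  by field.
by rewrite ax /s; field; rewrite gt_eqF.
Qed.

Lemma joukowski_range a x : 0 < a -> a < 1 -> a <= x <= 1 ->
  2 * Num.sqrt a / (1 + a) <= (x + a / x) / (1 + a) <= 1.
Proof.
move=> a0 a1 /andP[ax x1].
have sa : Num.sqrt a ^+ 2 = a by rewrite sqr_sqrtr // ltW.
have x0 : 0 < x by lra.
have p1 : 0 < 1 + a by lra.
rewrite ler_pM2r ?invr_gt0 // ler_pdivrMr // mul1r.
have -> : x + a / x = (x ^+ 2 + a) / x by field; rewrite gt_eqF.
rewrite ler_pdivlMr // ler_pdivrMr //.
have := sqr_ge0 (x - Num.sqrt a).
by move=> ?; apply/andP; split; nra.
Qed.

(** Both inequalities transport an approximant through the substitution: a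
    polynomial is pulled back, a Laurent sum is first averaged over x and a/x,
    two points of the domain with the same sign and the same image t. *)
Lemma sgn_error_joukowski a m : 0 < a -> a < 1 -> (0 < m)%N ->
  sgn_error m m a = sgn_error 0 m (2 * Num.sqrt a / (1 + a)).
Proof.
move=> a0 a1 m0; set b := 2 * _ / _.
have b0 : 0 < b by rewrite divr_gt0 ?mulr_gt0 ?sqrtr_gt0 ?addr_gt0.
have b1 : b <= 1.
  rewrite ler_pdivrMr ?mul1r ?addr_gt0 //.
  have : Num.sqrt a ^+ 2 = a by rewrite sqr_sqrtr // ltW.
  by nra.
have sgJ (x : R) : x != 0 -> Num.sg ((x + a / x) / (1 + a)) = Num.sg x.
  have pos (y : R) : 0 < y -> 0 < (y + a / y) / (1 + a).
    by move=> y0; rewrite divr_gt0 ?addr_gt0 ?divr_gt0.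
  case: (ltgtP x 0) => // hx _; last by rewrite !gtr0_sg ?pos.
  have -> : (x + a / x) / (1 + a) = - ((- x + a / - x) / (1 + a)).
    by rewrite invrN mulrN -opprD mulNr opprK.
  by rewrite sgrN (ltr0_sg hx) gtr0_sg // pos // oppr_gt0.
have nJ (x : R) : `|(x + a / x) / (1 + a)| = (`|x| + a / `|x|) / (1 + a).
  have pos (y : R) : 0 < y -> 0 < (y + a / y) / (1 + a).
    by move=> y0; rewrite divr_gt0 ?addr_gt0 ?divr_gt0.
  case: (ltgtP x 0) => hx; last first.
  - by rewrite hx normr0 invr0 !mulr0 addr0 mul0r normr0.
  - by rewrite gtr0_norm ?pos // gtr0_norm.
  - have -> : (x + a / x) / (1 + a) = - ((- x + a / - x) / (1 + a)).
      by rewrite invrN mulrN -opprD mulNr opprK.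
    by rewrite normrN (ltr0_norm hx) gtr0_norm // pos // oppr_gt0.
apply/eqP; rewrite eq_le; apply/andP; split; apply: le_sgn_error => f.
  move=> hf0; have [p [sp fp]] := hf0.
  have [c hc] := is_laurent_horner_joukowski a sp.
  have hL : approximants m m (laurent_sum m m c) by case: m m0 {hf0 sp hc} c => // m _ c; exists c.
  apply: le_trans (sgn_error_le a hL) _; apply: sgn_dist_le; first exact: ltW.
  move=> x hx; have x0 : x != 0 by rewrite -normr_gt0; case/andP: hx => + _; exact: lt_le_trans.
  rewrite -hc // -(sgJ x) // (_ : p.[_] = f ((x + a / x) / (1 + a))); last by rewrite fp.
  apply: approximants_le_sgn_dist hf0 _ => //.
  by rewrite nJ; exact: joukowski_range.
move=> hf; have [c fc] : exists c, f = laurent_sum m m c by case: m m0 hf.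
have [p [sp hp]] := laurent_average_poly c a0 m0.
have hP : @approximants R 0 m (fun x => p.[x]) by exists p.
apply: le_trans (sgn_error_le b hP) _; apply: sgn_dist_le => // t ht.
have [y /andP[ay y1] hy] := joukowski_onto a0 a1 ht.
have y0 : 0 < y by lra.
have t0 : t != 0 by rewrite -normr_gt0; case/andP: ht => + _; exact: lt_le_trans.
(* The preimage of |t| is moved to the side of t. *)
pose x := Num.sg t * y.
have sgx : Num.sg x = Num.sg t by rewrite /x sgrM sgr_id (gtr0_sg y0) mulr1.
have x0 : x != 0 by rewrite mulf_neq0 ?sgr_eq0 // gt_eqF.
have tx : (x + a / x) / (1 + a) = t.
  rewrite [RHS]numEsg -hy /x invfM.
  have -> : (Num.sg t)^-1 = Num.sg t.
    by case: (sgrP t) t0 => // _; rewrite ?eqxx // ?invr1 ?invrN1.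
  by ring.
have nx : `|x| = y by rewrite /x normrM normr_sg t0 mul1r gtr0_norm.
have hx : a <= `|x| <= 1 by rewrite nx ay.
have hax : a <= `|a / x| <= 1.
  rewrite normrM normfV nx (gtr0_norm a0) ler_pdivlMr // ler_pdivrMr //.
  by apply/andP; split; nra.
have sgax : Num.sg (a / x) = Num.sg t by rewrite sgrM sgrV (gtr0_sg a0) mul1r.
have h1 := approximants_le_sgn_dist a0 hf hx.
have h2 := approximants_le_sgn_dist a0 hf hax.
rewrite sgx in h1; rewrite sgax in h2.
rewrite -{2}tx hp // -fc.
have -> : Num.sg t - (f x + f (a / x)) / 2 =
  ((Num.sg t - f x) + (Num.sg t - f (a / x))) / 2 by field.
rewrite normrM [X in _ * X]gtr0_norm ?invr_gt0 // ler_pdivrMr //.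
apply: le_trans (ler_normD _ _) _; lra.
Qed.

End Laurent.

(** * Lower bounds from alternation, and odd antiderivatives *)

Section Alternation.
Variable R : realType.
Implicit Types (p q h v : {poly R}) (x y b M : R).

Lemma root_between p x y : x < y -> p.[x] * p.[y] < 0 ->
  exists2 z, x < z < y & root p z.
Proof.
move=> xy pxy.
have [px py] : p.[x] != 0 /\ p.[y] != 0.
  by split; apply/eqP => p0; move: pxy; rewrite p0 ?mul0r ?mulr0 ltxx.
wlog px0 : p pxy px py / p.[x] < 0.
  move=> H; case: (ltgtP p.[x] 0) => [||/eqP]; [exact: H| |by rewrite (negbTE px)].
  move=> px0; have [||||z hz rz] := H (- p); rewrite ?hornerN ?mulrNN ?oppr_eq0 ?oppr_lt0 //.
  by exists z => //; rewrite -rootN.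
have py0 : 0 < p.[y] by rewrite -(nmulr_rlt0 _ px0).
have [|z /andP[xz zy] rz] := @poly_ivt R p x y (ltW xy); first by rewrite !ltW.
exists z => //; rewrite !lt_neqAle xz zy !andbT; apply/andP; split; apply/eqP => e.
  by move: px; rewrite e; move/rootP: rz => ->; rewrite eqxx.
by move: py; rewrite -e; move/rootP: rz => ->; rewrite eqxx.
Qed.

(** A polynomial with N sign changes has N distinct roots. *)
Lemma alternation_size p (N : nat) (y : nat -> R) :
  (forall i, (i < N)%N -> y i < y i.+1) ->
  (forall i, (i <= N)%N -> 0 < (-1) ^+ i * p.[y i]) ->
  (N < size p)%N.
Proof.
move=> ymono ysgn.
have p0 : p != 0.
  by apply/eqP => p0; have := ysgn 0%N isT; rewrite p0 horner0 mulr0 ltxx.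
suff [s [<- us rs _]] : exists s, [/\ size s = N, uniq s, all (root p) s & all (fun z => z < y N) s].
  exact: max_poly_roots.
elim: N ymono ysgn => [|N IH] ymono ysgn; first by exists [::].
have [|i iN|s [ss us rs ls]] := IH; first by move=> i iN; apply: ymono; exact: ltnW.
  by apply: ysgn; exact: ltnW.
have sg : p.[y N] * p.[y N.+1] < 0.
  have := mulr_gt0 (ysgn N (leqnSn N)) (ysgn N.+1 (leqnn _)).
  by rewrite mulrACA -exprD addnS exprS addnn -mul2n exprM sqrrN !expr1n mulr1 mulN1r oppr_gt0.
have [z /andP[Nz zN] rz] := root_between (ymono N (ltnSn N)) sg.
exists (z :: s); split => /=; first by rewrite ss.
- rewrite us andbT; apply/negP => /(allP ls) zs.
  by have := lt_trans zs Nz; rewrite ltxx.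
- by rewrite rz.
- rewrite zN; apply/allP => t /(allP ls) tN.
  exact: lt_trans tN (ymono N (ltnSn N)).
Qed.

Lemma odd_poly_horner q x : x * (odd_poly q).[x ^+ 2] = (q.[x] - q.[- x]) / 2.
Proof.
rewrite -{2 3}(poly_even_odd q) !(hornerD, hornerM, horner_comp, hornerX, hornerXn).
by rewrite mulrNN; field.
Qed.

(** Let p(x) = x h(x^2) have errors of alternating signs and absolute values at
    least M at n+2 points of [b,1].  If q had an error below M, then p - q would
    alternate at these points, and so would its odd part, since the error of p at
    -x is the opposite of its error at x.  But the odd part is x g(x^2) with g of
    degree at most n, too small for n+1 sign changes. *)
Lemma vallee_poussin b M h (n : nat) (x : nat -> R) (sigma : R) : 0 < b ->
  (size h <= n.+1)%N -> `|sigma| = 1 ->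
  (forall i, (i <= n.+1)%N -> b <= x i <= 1) ->
  (forall i, (i < n.+1)%N -> x i < x i.+1) ->
  (forall i, (i <= n.+1)%N -> M <= sigma * (-1) ^+ i * (1 - x i * h.[x i ^+ 2])) ->
  M <= sgn_error 0 n.+1 b.
Proof.
move=> b0 sh s1 xb xmono alt; apply: le_sgn_error => f hf.
have [q [sq fq]] := hf.
rewrite leNgt; apply/negP => lt.
have : (n.+1 < size (sigma *: (odd_poly q - h)))%N.
  apply: (@alternation_size _ n.+1 (fun i => x i ^+ 2)) => i hi.
    have /andP[xi _] := xb i (ltnW hi).
    by have := xmono i hi; rewrite !expr2; nra.
  have /andP[bx x1] := xb i hi.
  have x0 : 0 < x i := lt_le_trans b0 bx.
  have hx : b <= `|x i| <= 1 by rewrite gtr0_norm // bx.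
  have hNx : b <= `|- x i| <= 1 by rewrite normrN.
  have h1 := approximants_le_sgn_dist b0 hf hx.
  have h2 := approximants_le_sgn_dist b0 hf hNx.
  rewrite sgrN (gtr0_sg x0) fq /= in h1 h2.
  rewrite -(pmulr_rgt0 _ x0) hornerZ hornerD hornerN.
  set s := sigma * (-1) ^+ i.
  have ns : `|s| = 1 by rewrite normrM s1 mul1r normrX normrN1 expr1n.
  have -> : x i * ((-1) ^+ i * (sigma * ((odd_poly q).[x i ^+ 2] - h.[x i ^+ 2]))) =
     s * (1 - x i * h.[x i ^+ 2]) - s * (((1 - q.[x i]) - (-1 - q.[- x i])) / 2).
    have := odd_poly_horner q (x i).
    set A := (odd_poly q).[_]; set B := h.[_] => e.
    have -> : (1 - q.[x i] - (-1 - q.[- x i])) / 2 = 1 - x i * A by rewrite e; field.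
    by rewrite /s; ring.
  rewrite subr_gt0; apply: lt_le_trans (alt i hi); apply: le_lt_trans lt.
  apply: le_trans (ler_norm _) _; rewrite normrM ns mul1r normrM.
  rewrite [X in _ * X]gtr0_norm ?invr_gt0 // ler_pdivrMr //.
  by apply: le_trans (ler_normB _ _) _; rewrite fq; lra.
apply/negP; rewrite -leqNgt (leq_trans (size_scale_leq _ _)) //.
rewrite (leq_trans (size_polyD _ _)) // geq_max size_polyN sh andbT.
by rewrite (leq_trans (size_odd_poly _)) //; lia.
Qed.

(** [x * (odd_primitive v).[x ^+ 2]] is the primitive of [v.[x ^+ 2]] that
    vanishes at 0. *)
Definition odd_primitive v : {poly R} := \poly_(i < size v) (v`_i / i.*2.+1%:R).

Lemma size_odd_primitive v : (size (odd_primitive v) <= size v)%N.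
Proof. exact: size_poly. Qed.

Lemma deriv_odd_primitive v : ('X * (odd_primitive v \Po 'X^2))^`() = v \Po 'X^2.
Proof.
apply/polyP => i; rewrite coef_deriv coefXM /= !coef_comp_poly_Xn //.
case: dvdnP => [[j ->]|]; last by rewrite mul0rn.
rewrite mulnK // coef_poly; case: ltnP => hj; last by rewrite mul0rn nth_default.
by rewrite -[LHS]mulr_natr muln2 mulfVK // pnatr_eq0.
Qed.

Lemma size_odd_part_approximant (h : {poly R}) n : (size h <= n.+1)%N ->
  (size ('X * (h \Po 'X^2))%R <= 2 * n.+1)%N.
Proof.
move=> sh; have H : (size ('X * (h \Po 'X^2))%R <= (size (h \Po 'X^2)).+1)%N.
  by rewrite (leq_trans (size_polyMleq _ _)) // size_polyX.
have := size_comp_poly_leq h ('X^2 : {poly R}); rewrite size_polyXn /= => H2.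
apply: leq_trans H _; apply: (@leq_trans ((size h).-1 * 2).+2) => //.
by move: sh; case: (size h) => [|k] /= ?; lia.
Qed.

Lemma is_derive_odd_primitive v x :
  is_derive x 1 (fun t => t * (odd_primitive v).[t ^+ 2]) v.[x ^+ 2].
Proof.
have -> : (fun t => t * (odd_primitive v).[t ^+ 2]) = horner ('X * (odd_primitive v \Po 'X^2)).
  by apply/funext => t; rewrite hornerM hornerX horner_comp hornerXn.
apply: DeriveDef; first exact: derivable_horner.
by rewrite -derive1E -derivE deriv_odd_primitive horner_comp hornerXn.
Qed.

End Alternation.

(** * The oscillation of the primitive on [b,1] *)

Section Oscillation.
Variables (R : realType) (b : R).
Hypotheses (b_gt0 : 0 < b) (b_lt1 : b < 1).
Implicit Types (w x y : R) (n : nat).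

(** The rate of geometric decay of the error: the singularity y = 0 of
    1 / sqrt y is the point z = 1/r in the coordinate z + 1/z = tau on the
    exterior of the unit circle, which corresponds to [b^2,1]. *)
Definition decay : R := (1 - b) / (1 + b).

Let b1_gt0 : 0 < 1 + b. Proof. by rewrite addr_gt0. Qed.
Let b1_neq0 : 1 + b != 0. Proof. exact: lt0r_neq0. Qed.
Let bm_neq0 : 1 - b != 0. Proof. by rewrite subr_eq0 eq_sym lt_eqF. Qed.
Let b2_neq0 : 1 - b ^+ 2 != 0.
Proof. by rewrite -[1](expr1n _ 2) subr_sqr mulf_neq0. Qed.

Lemma decay_gt0 : 0 < decay.
Proof. by rewrite divr_gt0 // subr_gt0. Qed.

Lemma decay_lt1 : decay < 1.
Proof. by rewrite /decay ltr_pdivrMr // mul1r; have := b_gt0; lra. Qed.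

(** The affine function of y with values -2 at y = 1 and 2 at y = b^2; it is
    r + 1/r at y = 0. *)
Definition tau : {poly R} :=
  (2 * (1 + b ^+ 2) / (1 - b ^+ 2))%:P - (4 / (1 - b ^+ 2)) *: 'X.

(** U_n - r U_(n-1) evaluated at tau/2, with U_n the Chebyshev polynomials of the
    second kind. *)
Fixpoint chebV n : {poly R} :=
  if n is m.+1 then
    if m is k.+1 then tau * chebV m - chebV k else tau - decay%:P
  else 1.

Lemma chebVSS n : chebV n.+2 = tau * chebV n.+1 - chebV n.
Proof. by []. Qed.

Lemma size_tau : (size tau <= 2)%N.
Proof.
rewrite (leq_trans (size_polyD _ _)) // geq_max size_polyN.
rewrite (leq_trans (size_polyC_leq1 _)) //=.
by rewrite (leq_trans (size_scale_leq _ _)) // size_polyX.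
Qed.

Lemma size_chebV n : (size (chebV n) <= n.+1)%N.
Proof.
suff [] : (size (chebV n) <= n.+1)%N /\ (size (chebV n.+1) <= n.+2)%N by [].
elim: n => [|n [IH1 IH2]].
  split; first by rewrite size_poly1.
  rewrite (leq_trans (size_polyD _ _)) // geq_max size_polyN size_tau.
  by rewrite (leq_trans (size_polyC_leq1 _)).
split=> //; rewrite chebVSS (leq_trans (size_polyD _ _)) // geq_max size_polyN.
apply/andP; split; last by rewrite (leq_trans IH1) // leqW.
rewrite (leq_trans (size_polyMleq _ _)) //.
by have := size_tau; move: IH2; lia.
Qed.

(** The imaginary and real parts of e^(inw) (e^(iw) - r). *)
Definition osc_sin n w := sin (n.+1%:R * w) - decay * sin (n%:R * w).
Definition osc_cos n w := cos (n.+1%:R * w) - decay * cos (n%:R * w).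
(** [ysq] maps [0,pi] increasingly onto [b^2,1]; the point of [b,1] with
    parameter w is [Num.sqrt (ysq w)]. *)
Definition ysq w := (1 + b ^+ 2) / 2 - (1 - b ^+ 2) / 2 * cos w.

Lemma tau_ysq w : tau.[ysq w] = 2 * cos w.
Proof.
rewrite /tau !hornerE /ysq.
by field.
Qed.

Lemma chebV_sin n w : sin w * (chebV n).[ysq w] = osc_sin n w.
Proof.
have H k : osc_sin k.+2 w = 2 * cos w * osc_sin k.+1 w - osc_sin k w.
  rewrite /osc_sin.
  have A j : sin (j.+2%:R * w) = 2 * cos w * sin (j.+1%:R * w) - sin (j%:R * w).
    rewrite -(@natr1 _ j.+1) -(@natr1 _ j) !mulrDl !mul1r !(sinD, cosD).
    by ring: (sin2cos2 w).
  by rewrite 2!A; ring.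
suff [] : sin w * (chebV n).[ysq w] = osc_sin n w /\
  sin w * (chebV n.+1).[ysq w] = osc_sin n.+1 w by [].
elim: n => [|n [IH1 IH2]].
  rewrite /= /osc_sin hornerD hornerN tau_ysq !hornerE ?mul0r ?sin0 ?mulr0 ?subr0 ?mul1r.
  by split=> //; rewrite mulr2n mulrDl mul1r mulrDl !mul1r sinD; ring.
split=> //; rewrite chebVSS hornerD hornerN hornerM tau_ysq mulrBr mulrCA IH1 IH2.
by rewrite H.
Qed.

Lemma osc_cos2Dsin2 n w :
  osc_cos n w ^+ 2 + osc_sin n w ^+ 2 = 4 * ysq w / (1 + b) ^+ 2.
Proof.
rewrite /osc_cos /osc_sin -(@natr1 _ n) mulrDl mul1r sinD cosD /decay /ysq.
by field: (sin2cos2 w) (sin2cos2 (n%:R * w)).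
Qed.

Lemma ysq_bounds w : b ^+ 2 <= ysq w <= 1.
Proof.
have := cos_geN1 w; have := cos_le1 w; rewrite /ysq => h1 h2.
have c0 : 0 <= (1 - b ^+ 2) / 2 by rewrite divr_ge0 // subr_ge0 expr_le1 // ltW.
by apply/andP; split; nra.
Qed.

Lemma ysq_gt0 w : 0 < ysq w.
Proof. by case/andP: (ysq_bounds w) => + _; apply: lt_le_trans; rewrite exprn_gt0. Qed.

Lemma sqr_sqrt_ysq w : Num.sqrt (ysq w) ^+ 2 = ysq w.
Proof. by rewrite sqr_sqrtr // ltW // ysq_gt0. Qed.

Lemma sqrt_ysq_bounds w : b <= Num.sqrt (ysq w) <= 1.
Proof.
have /andP[h1 h2] := ysq_bounds w.
apply/andP; split.
  by rewrite -(ger0_norm (ltW b_gt0)) -sqrtr_sqr ler_sqrt // ltW // ysq_gt0.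
by rewrite -(sqrtr1 R) ler_sqrt.
Qed.

(** The boundary term of the integration by parts applied to the primitive of
    [chebV n] at x^2. *)
Definition boundary n w := - ((1 - b ^+ 2) / 2) * osc_cos n w * Num.sqrt (ysq w)
  / ((2 * n + 1)%:R * ysq w + b).

Definition residual n w :=
  Num.sqrt (ysq w) * (odd_primitive (chebV n)).[Num.sqrt (ysq w) ^+ 2] - boundary n w.

(** The left-hand side is C' y, with C = [osc_cos n] and y = x^2.  The identity
    says that (C/x)' = - (S/x) (d + b/y)/2, that is, that the argument of C + iS
    has derivative (d + b/y)/2. *)
Lemma osc_cos_deriv_id n w :
  - (n.+1%:R * sin (n.+1%:R * w) - decay * (n%:R * sin (n%:R * w))) * ysq w
  = osc_cos n w * ((1 - b ^+ 2) / 2 * sin w) / 2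
    - osc_sin n w * ((2 * n + 1)%:R * ysq w + b) / 2.
Proof.
have e : n.+1%:R * w = n%:R * w + w by rewrite -natr1 mulrDl mul1r.
rewrite /osc_cos /osc_sin e natrD natrM -(@natr1 _ n) sinD cosD /decay /ysq.
by field: (sin2cos2 w).
Qed.

Instance is_derive_ysq w : is_derive w 1 ysq ((1 - b ^+ 2) / 2 * sin w).
Proof.
apply: is_derive_eq.
by rewrite -![_ *: _]/(_ * _); ring.
Qed.

Lemma is_derive_osc_cos n w : is_derive w 1 (osc_cos n)
  (- (n.+1%:R * sin (n.+1%:R * w) - decay * (n%:R * sin (n%:R * w)))).
Proof.
have H (k : R) : is_derive w 1 (fun t => cos (k * t)) (- (k * sin (k * w))).
  apply: is_derive_eq (is_derive1_comp (is_derive_cos _) _) _.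
  by rewrite -![_ *: _]/(_ * _); ring.
apply: is_derive_eq.
by rewrite -![_ *: _]/(_ * _); ring.
Qed.

Lemma is_derive_sqrt_ysq w : is_derive w 1 (fun t => Num.sqrt (ysq t))
  ((1 - b ^+ 2) / 2 * sin w / (2 * Num.sqrt (ysq w))).
Proof.
apply: is_derive_eq (is_derive1_comp (is_derive1_sqrt (ysq_gt0 w)) _) _.
by rewrite mulrC.
Qed.

Lemma denom_gt0 n w : 0 < (2 * n + 1)%:R * ysq w + b.
Proof. by rewrite addr_gt0 // mulr_gt0 ?ltr0n ?ysq_gt0 // addn1. Qed.

(** The first term is the derivative of the primitive of [chebV n] along
    [Num.sqrt (ysq w)], because of [chebV_sin]; the second is O(1/d^2). *)
Lemma is_derive_boundary n w : is_derive w 1 (boundary n)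
  (osc_sin n w * ((1 - b ^+ 2) / 2) / (2 * Num.sqrt (ysq w))
   - b * ((1 - b ^+ 2) / 2) ^+ 2 * osc_cos n w * sin w
     / (Num.sqrt (ysq w) * ((2 * n + 1)%:R * ysq w + b) ^+ 2)).
Proof.
have dC := is_derive_osc_cos n w.
have ds := is_derive_sqrt_ysq w.
have dn0 := denom_gt0 n w.
have s0 : Num.sqrt (ysq w) != 0 by rewrite gt_eqF // sqrtr_gt0 ysq_gt0.
have dD : is_derive w 1 (fun t => ((2 * n + 1)%:R * ysq t + b)^-1)
   (- ((2 * n + 1)%:R * ((1 - b ^+ 2) / 2 * sin w)) / ((2 * n + 1)%:R * ysq w + b) ^+ 2).
  apply: is_derive_eq (is_deriveV _ _) _; first exact: lt0r_neq0.
  by rewrite -![_ *: _]/(_ * _); ring.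
rewrite /boundary.
apply: is_derive_eq.
rewrite -![_ *: _]/(_ * _).
have /eqP := osc_cos_deriv_id n w.
have y0 : ysq w != 0 by rewrite gt_eqF // ysq_gt0.
rewrite -[_ == _](inj_eq (mulIf (invr_neq0 y0))) mulfK // => /eqP ->.
have := sqr_sqrt_ysq w; move: s0; set s := Num.sqrt _ => s0 es.
rewrite -es natrD natrM in dn0 *; field.
by rewrite s0 gt_eqF.
Qed.

Lemma is_derive_residual n w : is_derive w 1 (residual n)
  (b * ((1 - b ^+ 2) / 2) ^+ 2 * osc_cos n w * sin w
     / (Num.sqrt (ysq w) * ((2 * n + 1)%:R * ysq w + b) ^+ 2)).
Proof.
have dB := is_derive_boundary n w.
have dW : is_derive w 1 (fun t => Num.sqrt (ysq t) * (odd_primitive (chebV n)).[Num.sqrt (ysq t) ^+ 2])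
   ((chebV n).[ysq w] * ((1 - b ^+ 2) / 2 * sin w / (2 * Num.sqrt (ysq w)))).
  apply: is_derive_eq (@is_derive1_comp _ (fun t => t * (odd_primitive (chebV n)).[t ^+ 2])
    (fun t => Num.sqrt (ysq t)) w _ _ (is_derive_odd_primitive _ _) (is_derive_sqrt_ysq w)) _.
  by rewrite sqr_sqrt_ysq.
rewrite /residual; apply: is_derive_eq.
by rewrite -chebV_sin; ring.
Qed.

Lemma norm_osc_cos n w : `|osc_cos n w| <= 2 * Num.sqrt (ysq w) / (1 + b).
Proof.
rewrite -ler_sqr ?nnegrE ?divr_ge0 ?mulr_ge0 ?sqrtr_ge0 ?(ltW b1_gt0) //.
rewrite real_normK ?num_real // exprMn exprVn exprMn sqr_sqrt_ysq.
have -> : 2 ^+ 2 * ysq w / (1 + b) ^+ 2 = osc_cos n w ^+ 2 + osc_sin n w ^+ 2.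
  by rewrite osc_cos2Dsin2; ring.
by rewrite lerDl sqr_ge0.
Qed.

(** Uses |C| <= 2x, (1-b^2)/2 <= 1/2 and d y + b >= d b^2. *)
Lemma norm_residual_deriv n w :
  `|b * ((1 - b ^+ 2) / 2) ^+ 2 * osc_cos n w * sin w
     / (Num.sqrt (ysq w) * ((2 * n + 1)%:R * ysq w + b) ^+ 2)|
  <= (b ^+ 3)^-1 / (2 * n + 1)%:R ^+ 2.
Proof.
set d := (2 * n + 1)%:R; set s := Num.sqrt _.
have s0 : 0 < s by rewrite sqrtr_gt0 ysq_gt0.
have d0 : 0 < d by rewrite ltr0n addn1.
have D0 := denom_gt0 n w.
have E0 : 0 < s * (d * ysq w + b) ^+ 2 by rewrite mulr_gt0 ?exprn_gt0.
rewrite normrM normfV (gtr0_norm E0) ler_pdivrMr //.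
have c1 : 0 <= (1 - b ^+ 2) / 2 <= 1 / 2.
  have : b ^+ 2 <= 1 by rewrite expr_le1 // ltW.
  by have := sqr_ge0 b => ? ?; apply/andP; split; lra.
have hC : `|osc_cos n w| <= 2 * s.
  apply: le_trans (norm_osc_cos n w) _; rewrite -/s ler_pdivrMr //.
  by rewrite ler_peMr ?mulr_ge0 ?(ltW s0) //; have := b_gt0; lra.
have yb : d * b ^+ 2 <= d * ysq w + b.
  by have /andP[h _] := ysq_bounds w; rewrite (le_trans (ler_wpM2l (ltW d0) h)) // lerDl ltW.
apply: (@le_trans _ _ (b * s)).
  case/andP: c1; set c := (1 - b ^+ 2) / 2 => c0 c1.
  rewrite -[_ * sin w]mulrA normrM (ger0_norm (mulr_ge0 (ltW b_gt0) (sqr_ge0 c))).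
  rewrite normrM -mulrA ler_pM2l //.
  have := sin_max w; have := normr_ge0 (sin w); have := normr_ge0 (osc_cos n w).
  set A := `|osc_cos _ _| in hC *; set B := `|sin w| => A0 B0 B1.
  have : c ^+ 2 <= 1 / 4 by rewrite expr2; nra.
  have : A * B <= 2 * s by nra.
  have : 0 <= A * B by exact: mulr_ge0.
  have := sqr_ge0 c.
  by set u := c ^+ 2; set v := A * B => *; nra.
rewrite [X in _ <= X](_ : _ = s * ((d * ysq w + b) ^+ 2 / (b ^+ 3 * d ^+ 2))); last first.
  by field; rewrite !gt_eqF.
rewrite mulrC ler_pM2l // ler_pdivlMr ?mulr_gt0 ?exprn_gt0 //.
have -> : b * (b ^+ 3 * d ^+ 2) = (d * b ^+ 2) ^+ 2 by ring.
by rewrite ler_sqr ?nnegrE ?(ltW D0) // mulr_ge0 ?sqr_ge0 // ltW.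
Qed.

(** The mean value theorem; the factor 4 bounds pi. *)
Lemma residual_cst n w1 w2 : 0 <= w1 <= pi -> 0 <= w2 <= pi ->
  `|residual n w1 - residual n w2| <= 4 * (b ^+ 3)^-1 / (2 * n + 1)%:R ^+ 2.
Proof.
wlog w12 : w1 w2 / w2 <= w1.
  move=> H h1 h2; case: (leP w2 w1) => [|/ltW] h; first exact: H.
  by rewrite distrC; exact: H.
move=> /andP[_ w1pi] /andP[w20 _].
have [|c _ ->] := @MVT_segment R (residual n) _ w2 w1 w12 (fun x _ => is_derive_residual n x).
  apply: continuous_subspaceT => x.
  by apply: differentiable_continuous; apply/derivable1_diffP; have [] := is_derive_residual n x.
rewrite normrM mulrC -[X in _ <= X]mulrA; apply: ler_pM => //; last exact: norm_residual_deriv.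
have := @pihalf_lt2 R; rewrite ger0_norm ?subr_ge0 //; lra.
Qed.

Lemma norm_boundary n w : `|boundary n w| <= (1 - b) / (2 * n + 1)%:R.
Proof.
have D0 := denom_gt0 n w.
have d0 : 0 < (2 * n + 1)%:R :> R by rewrite ltr0n addn1.
have s0 : 0 < Num.sqrt (ysq w) by rewrite sqrtr_gt0 ysq_gt0.
have es := sqr_sqrt_ysq w.
rewrite /boundary normrM normfV (gtr0_norm D0) ler_pdivrMr //.
rewrite normrM (gtr0_norm s0) normrM normrN.
have c0 : 0 <= (1 - b ^+ 2) / 2 by rewrite divr_ge0 // subr_ge0 expr_le1 // ltW.
rewrite (ger0_norm c0).
apply: (@le_trans _ _ ((1 - b ^+ 2) / 2 * (2 * Num.sqrt (ysq w) / (1 + b)) * Num.sqrt (ysq w))).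
  by rewrite ler_pM2r // ler_wpM2l // norm_osc_cos.
have -> : (1 - b ^+ 2) / 2 * (2 * Num.sqrt (ysq w) / (1 + b)) * Num.sqrt (ysq w) = (1 - b) * ysq w.
  by rewrite -[ysq w in RHS]es; field.
rewrite -mulrA ler_pM2l ?subr_gt0 // mulrC ler_pdivlMr // mulrC lerDl ltW //.
Qed.

Lemma osc_sinE n w : osc_sin n w =
  sin (n.+1%:R * w) * (1 - decay * cos w) + decay * cos (n.+1%:R * w) * sin w.
Proof.
have -> : osc_sin n w = sin (n.+1%:R * w) - decay * sin (n.+1%:R * w - w).
  by rewrite /osc_sin -(@natr1 _ n) mulrDl mul1r addrK.
by rewrite sinB; ring.
Qed.

Lemma osc_cosE n w : osc_cos n w =
  cos (n.+1%:R * w) * (1 - decay * cos w) - decay * sin (n.+1%:R * w) * sin w.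
Proof.
have -> : osc_cos n w = cos (n.+1%:R * w) - decay * cos (n.+1%:R * w - w).
  by rewrite /osc_cos -(@natr1 _ n) mulrDl mul1r addrK.
by rewrite cosB; ring.
Qed.

Lemma one_sub_decay_cos_gt0 w : 0 < 1 - decay * cos w.
Proof.
have := cos_le1 w; have := decay_gt0; have := decay_lt1.
by rewrite subr_gt0; set c := cos w; set r := decay => *; nra.
Qed.

(** At (n+1) w = (i + 1/2) pi the cosine in [osc_sinE] vanishes, leaving
    (-1)^i (1 - r cos w), so a zero lies between two consecutive such
    points.  The zeros 0 and pi are at the ends. *)
Lemma osc_sin_zero n i : (i <= n.+1)%N -> exists w,
  [/\ 0 <= w <= pi, (i%:R - 2^-1) * pi < n.+1%:R * w, n.+1%:R * w < (i%:R + 2^-1) * pi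
    & osc_sin n w = 0].
Proof.
have p0 := @pi_gt0 R.
have N0 : 0 < n.+1%:R :> R by rewrite ltr0n.
case: i => [|i] hi.
  exists 0; split; rewrite ?lexx ?ltW ?mulr0 ?sub0r ?add0r //.
  - by rewrite mulNr oppr_lt0 mulr_gt0.
  - by rewrite mulr_gt0.
  - by rewrite /osc_sin !mulr0 sin0 mulr0 subr0.
have [e|ne] := eqVneq i n.
  exists pi; rewrite e; split; rewrite ?lexx ?ltW //.
  - by rewrite ltr_pM2r // gtrBl.
  - by rewrite ltr_pM2r // ltrDl.
  - have h (k : nat) : sin (k%:R * pi) = 0 :> R.
      by rewrite mulr_natl -[_ *+ _]add0r (alternatingn (@sinDpi R)) sin0 mulr0.
    by rewrite /osc_sin !h mulr0 subr0.
have iN : (i.+1 <= n)%N by rewrite ltn_neqAle ne.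
have hf : i%:R + 2^-1 = i.+1%:R - 2^-1 :> R by rewrite -natr1; field.
pose u (j : nat) : R := (j%:R + 2^-1) * pi / n.+1%:R.
have Nu j : n.+1%:R * u j = pi / 2 + pi *+ j.
  by rewrite /u mulrC divfK ?lt0r_neq0 // mulrDl mulr_natl mulrC addrC mulrC.
have su j : osc_sin n (u j) = (-1) ^+ j * (1 - decay * cos (u j)).
  rewrite osc_sinE Nu (alternatingn (@sinDpi R)) (alternatingn (@cosDpi R)).
  by rewrite sin_pihalf cos_pihalf; ring.
have u01 : u i < u i.+1.
  by rewrite /u ltr_pM2r ?invr_gt0 // ltr_pM2r // ltrD2r ltr_nat.
have ct : continuous (osc_sin n).
  move=> x; apply: differentiable_continuous; apply/derivable1_diffP.
  by rewrite /osc_sin; exact: ex_derive.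
have [|c] := @IVT R (osc_sin n) (u i) (u i.+1) 0 (ltW u01) (continuous_subspaceT ct).
  rewrite !su exprS mulN1r.
  have := one_sub_decay_cos_gt0 (u i); have := one_sub_decay_cos_gt0 (u i.+1).
  rewrite -signr_odd; case: (odd i); rewrite ?expr1 ?expr0 ?mul1r ?opprK ?mulN1r ?mul1r => h1 h2.
    by rewrite ge_min le_max oppr_le0 (ltW h2) (ltW h1) orbT.
  by rewrite ge_min le_max oppr_le0 (ltW h2) (ltW h1) orbT.
rewrite in_itv /= => /andP[ci ci1] c0; exists c; split => //.
- apply/andP; split.
    by apply: le_trans ci; rewrite /u divr_ge0 // mulr_ge0 ?(ltW p0) // addr_ge0.
  apply: le_trans ci1 _; rewrite /u ler_pdivrMr // mulrC ler_pM2l //.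
  have : i.+1%:R <= n%:R :> R by rewrite ler_nat.
  by rewrite -(@natr1 _ n); lra.
- rewrite lt_neqAle; apply/andP; split.
    apply/eqP => e; have := su i.
    have -> : u i = c.
      by rewrite /u; apply: (mulIf (lt0r_neq0 N0)); rewrite divfK ?lt0r_neq0 // [RHS]mulrC -e hf.
    rewrite c0 => /esym/eqP; rewrite mulf_eq0 signr_eq0 /=.
    by rewrite gt_eqF // one_sub_decay_cos_gt0.
  by move: ci; rewrite /u ler_pdivrMr // hf [c * _]mulrC.
- rewrite lt_neqAle; apply/andP; split.
    apply/eqP => e; have := su i.+1.
    have -> : u i.+1 = c.
      by rewrite /u; apply: (mulIf (lt0r_neq0 N0)); rewrite divfK ?lt0r_neq0 // [RHS]mulrC -e.
    rewrite c0 => /esym/eqP; rewrite mulf_eq0 signr_eq0 /=.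
    by rewrite gt_eqF // one_sub_decay_cos_gt0.
  by move: ci1; rewrite /u ler_pdivlMr // mulrC.
Qed.

End Oscillation.

(** * Two-sided bounds for the error of best approximation *)

Section ErrorBounds.
Variables (R : realType) (b : R).
Hypotheses (b_gt0 : 0 < b) (b_lt1 : b < 1).
Implicit Types (w x y : R) (n : nat).

Let b1_gt0 : 0 < 1 + b. Proof. by rewrite addr_gt0. Qed.
Let c_gt0 : 0 < 1 - b ^+ 2.
Proof. by rewrite subr_gt0 expr_lt1 // ltW. Qed.

Lemma sqrt_ysq_onto x : b <= x <= 1 -> exists2 w, 0 <= w <= pi & Num.sqrt (ysq b w) = x.
Proof.
move=> /andP[bx x1]; have x0 : 0 < x := lt_le_trans b_gt0 bx.
set c := (1 + b ^+ 2 - 2 * x ^+ 2) / (1 - b ^+ 2).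
have hc : -1 <= c <= 1.
  rewrite /c ler_pdivlMr // ler_pdivrMr //.
  by apply/andP; split; have := b_gt0; nra.
exists (acos c); first by rewrite acos_ge0 ?acos_lepi.
have -> : ysq b (acos c) = x ^+ 2.
  by rewrite /ysq acosK // /c; field; rewrite gt_eqF.
by rewrite sqrtr_sqr gtr0_norm.
Qed.

(** The approximant is the odd primitive divided by the constant u of its
    expansion; u is the value of [residual] at pi. *)
Lemma sgn_error_upper n : residual b n pi != 0 ->
  `|residual b n pi| * sgn_error 0 n.+1 b <=
    (1 - b) / (2 * n + 1)%:R + 4 * (b ^+ 3)^-1 / (2 * n + 1)%:R ^+ 2.
Proof.
set u := residual b n pi => u0; set M := _ + _.
rewrite mulrC -ler_pdivlMr ?normr_gt0 //.
pose h := u^-1 *: odd_primitive (chebV b n).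
have hq : approximants 0 n.+1 (horner ('X * (h \Po 'X^2))).
  exists ('X * (h \Po 'X^2)); split => //; apply: size_odd_part_approximant.
  rewrite (leq_trans (size_scale_leq _ _)) // (leq_trans (size_odd_primitive _)) //.
  exact: size_chebV.
apply: le_trans (sgn_error_le b hq) _; apply: sgn_dist_le; first exact: ltW.
move=> x hx; have x0 : x != 0.
  by rewrite -normr_gt0; case/andP: hx => + _; exact: lt_le_trans.
rewrite !hornerE /= horner_comp hornerXn.
have -> : Num.sg x - x * h.[x ^+ 2] = Num.sg x * (1 - `|x| * h.[`|x| ^+ 2]).
  have -> : `|x| ^+ 2 = x ^+ 2 by rewrite -normrX ger0_norm ?sqr_ge0.
  by rewrite [RHS]mulrBr mulr1 mulrA -numEsg.
rewrite normrM normr_sg x0 mul1r.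
have [w wpi <-] := sqrt_ysq_onto hx.
have -> : 1 - Num.sqrt (ysq b w) * h.[Num.sqrt (ysq b w) ^+ 2]
  = ((u - residual b n w) - boundary b n w) / u.
  by rewrite /residual /h hornerZ; field.
rewrite normrM normfV ler_pM2r ?invr_gt0 ?normr_gt0 //.
apply: le_trans (ler_normB _ _) _; rewrite addrC; apply: lerD.
  exact: norm_boundary.
by apply: residual_cst => //; rewrite pi_ge0 lexx.
Qed.

(** Where S = 0, the modulus of C + iS gives |C| = 2x/(1+b), and
    C cos((n+1)w) = 1 - r cos w > 0 gives C the sign of cos((n+1)w). *)
Lemma boundary_at_zero n w i : osc_sin b n w = 0 ->
  0 < (-1) ^+ i * cos (n.+1%:R * w) ->
  (1 - b) / ((2 * n + 1)%:R + b^-1) <= - ((-1) ^+ i * boundary b n w).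
Proof.
move=> S0 sgc.
set s := Num.sqrt (ysq b w).
have s0 : 0 < s by rewrite sqrtr_gt0 ysq_gt0.
have es : s ^+ 2 = ysq b w := sqr_sqrt_ysq b_gt0 b_lt1 w.
have D0 := denom_gt0 b_gt0 b_lt1 n w.
have C0 : 0 < (-1) ^+ i * osc_cos b n w.
  have H : osc_cos b n w * cos (n.+1%:R * w) = 1 - decay b * cos w.
    have : osc_cos b n w * cos (n.+1%:R * w) + osc_sin b n w * sin (n.+1%:R * w) = 1 - decay b * cos w.
      by rewrite osc_cosE osc_sinE; ring: (sin2cos2 (n.+1%:R * w)).
    by rewrite S0 mul0r addr0.
  rewrite -(pmulr_lgt0 _ sgc) mulrACA -exprD addnn -mul2n exprM sqrrN !expr1n mul1r H.
  exact: one_sub_decay_cos_gt0.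
have C1 : (-1) ^+ i * osc_cos b n w = 2 * s / (1 + b).
  apply/eqP; rewrite -(@eqrXn2 _ 2) ?(ltW C0) ?divr_ge0 ?mulr_ge0 ?(ltW s0) ?(ltW b1_gt0) //.
  rewrite exprMn -exprM mulnC exprM sqrrN !expr1n mul1r.
  have := osc_cos2Dsin2 b_gt0 n w; rewrite S0 expr0n addr0 => ->.
  by apply/eqP; rewrite -es; field; rewrite gt_eqF.
have -> : - ((-1) ^+ i * boundary b n w) = (1 - b) * (s ^+ 2 / ((2 * n + 1)%:R * ysq b w + b)).
  have -> : - ((-1) ^+ i * boundary b n w) =
     (1 - b ^+ 2) / 2 * ((-1) ^+ i * osc_cos b n w) * s / ((2 * n + 1)%:R * ysq b w + b).
    by rewrite /boundary -/s; ring.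
  rewrite C1; move: D0; set D := _ + b => D0.
  by field; rewrite !gt_eqF.
rewrite ler_pM2l ?subr_gt0 // es ler_pdivlMr // mulrC ler_pdivrMr; last first.
  by rewrite addr_gt0 ?invr_gt0 // ltr0n addn1.
have /andP[hy _] := ysq_bounds b_gt0 b_lt1 w.
have -> : ysq b w * ((2 * n + 1)%:R + b^-1) = (2 * n + 1)%:R * ysq b w + ysq b w / b by ring.
by rewrite lerD2l ler_pdivlMr // -expr2.
Qed.

(** The alternation points are the zeros of [osc_sin]; they are increasing because
    (n+1) times the i-th one lies within pi/2 of i pi. *)
Lemma sgn_error_lower n : residual b n pi != 0 ->
  (1 - b) / ((2 * n + 1)%:R + b^-1) - 4 * (b ^+ 3)^-1 / (2 * n + 1)%:R ^+ 2
  <= `|residual b n pi| * sgn_error 0 n.+1 b.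
Proof.
set u := residual b n pi => u0; set M := _ - _.
rewrite [X in _ <= X]mulrC -ler_pdivrMr ?normr_gt0 //.
have N0 : 0 < n.+1%:R :> R by rewrite ltr0n.
have p0 := @pi_gt0 R.
have /boolp.choice[th hth] : forall i : nat, exists w, (i <= n.+1)%N ->
  [/\ 0 <= w <= pi, (i%:R - 2^-1) * pi < n.+1%:R * w, n.+1%:R * w < (i%:R + 2^-1) * pi
    & osc_sin b n w = 0].
  move=> i; have [hi|hi] := leqP i n.+1; last by exists 0.
  by have [w hw] := osc_sin_zero b_gt0 b_lt1 hi; exists w.
pose h := u^-1 *: odd_primitive (chebV b n).
apply: (@vallee_poussin R b _ h n (fun i => Num.sqrt (ysq b (th i))) (Num.sg u)) => //.
- rewrite (leq_trans (size_scale_leq _ _)) // (leq_trans (size_odd_primitive _)) //.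
  exact: size_chebV.
- by rewrite normr_sg u0.
- by move=> i _; exact: sqrt_ysq_bounds.
- move=> i hi; have [/andP[w0 wpi] _ wlt _] := hth i (ltnW hi).
  have [/andP[w0' wpi'] wgt' _ _] := hth i.+1 hi.
  have hf : i%:R + 2^-1 = i.+1%:R - 2^-1 :> R by rewrite -natr1; field.
  rewrite ltr_sqrt ?ysq_gt0 // /ysq ltrD2l ltrN2 ltr_pM2l; last by rewrite divr_gt0.
  rewrite ltr_cos ?in_itv /= ?w0 ?wpi ?w0' ?wpi' //.
  by rewrite -(ltr_pM2l N0); apply: lt_trans wlt _; rewrite hf.
- move=> i hi; have [wpi wgt wlt S0] := hth i hi.
  have sgc : 0 < (-1) ^+ i * cos (n.+1%:R * th i).
    have -> : cos (n.+1%:R * th i) = (-1) ^+ i * cos (n.+1%:R * th i - pi *+ i).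
      by rewrite -(alternatingn (@cosDpi R)) subrK.
    rewrite mulrA -exprD addnn -mul2n exprM sqrrN !expr1n mul1r.
    apply: cos_gt0_pihalf; rewrite -mulr_natl ltrBrDr ltrBlDr.
    by apply/andP; split; [apply: le_lt_trans wgt|apply: lt_le_trans wlt _]; lra.
  have hb := boundary_at_zero S0 sgc.
  have hr : `|u - residual b n (th i)| <= 4 * (b ^+ 3)^-1 / (2 * n + 1)%:R ^+ 2.
    by apply: residual_cst => //; rewrite pi_ge0 lexx.
  have -> : Num.sg u * (-1) ^+ i * (1 - Num.sqrt (ysq b (th i)) * h.[Num.sqrt (ysq b (th i)) ^+ 2])
    = ((-1) ^+ i * (u - residual b n (th i)) - (-1) ^+ i * boundary b n (th i)) / `|u|.
    have e : Num.sg u = u / `|u| by rewrite {2}[u]numEsg mulfK // normr_eq0.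
    have nu0 : `|u| != 0 by rewrite normr_eq0.
    by rewrite e /residual /h hornerZ; field; rewrite u0 nu0.
  rewrite ler_pM2r ?invr_gt0 ?normr_gt0 //.
  have : `|(-1) ^+ i * (u - residual b n (th i))| <= 4 * (b ^+ 3)^-1 / (2 * n + 1)%:R ^+ 2.
    by rewrite normrM normrX normrN1 expr1n mul1r.
  rewrite ler_norml => /andP[h1 _]; rewrite /M addrC; apply: lerD => //.
Qed.

End ErrorBounds.

(** * Growth of the kernel on [0,b] *)

Section Growth.
Variables (R : realType) (b : R).
Hypotheses (b_gt0 : 0 < b) (b_lt1 : b < 1).
Implicit Types (w x y : R) (n : nat).

Local Notation r := (decay b).
Let b1_gt0 : 0 < 1 + b. Proof. by rewrite addr_gt0. Qed.
Let c_gt0 : 0 < 1 - b ^+ 2.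
Proof. by rewrite subr_gt0 expr_lt1 // ltW. Qed.
Let r_gt0 : 0 < r. Proof. exact: decay_gt0. Qed.
Let r_lt1 : r < 1. Proof. exact: decay_lt1. Qed.

(** The root of z + 1/z = tau that is at least 1. *)
Definition zeta y := ((tau b).[y] + Num.sqrt ((tau b).[y] ^+ 2 - 4)) / 2.

Lemma tauE y : (tau b).[y] = r + r^-1 - 4 * y / (1 - b ^+ 2).
Proof.
rewrite /tau !hornerE /decay; field.
by rewrite !gt_eqF // ?subr_gt0.
Qed.

Lemma tau_ge2 y : y <= b ^+ 2 -> 2 <= (tau b).[y].
Proof.
move=> yb; rewrite /tau !hornerE -subr_ge0.
have -> : 2 * (1 + b ^+ 2) / (1 - b ^+ 2) - 4 / (1 - b ^+ 2) * y - 2 =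
   4 * (b ^+ 2 - y) / (1 - b ^+ 2) by field; rewrite gt_eqF.
by rewrite divr_ge0 ?(ltW c_gt0) // mulr_ge0 // subr_ge0.
Qed.

Lemma zeta_ge1 y : y <= b ^+ 2 -> 1 <= zeta y.
Proof.
move=> /tau_ge2 t2; rewrite /zeta.
by have := sqrtr_ge0 ((tau b).[y] ^+ 2 - 4); lra.
Qed.

Lemma zetaDV y : y <= b ^+ 2 -> zeta y + (zeta y)^-1 = (tau b).[y].
Proof.
move=> yb; have z1 := zeta_ge1 yb; have t2 := tau_ge2 yb.
have z0 : zeta y != 0 by rewrite gt_eqF // (lt_le_trans _ z1).
apply: (mulIf z0); rewrite mulrDl mulVf //.
have : Num.sqrt ((tau b).[y] ^+ 2 - 4) ^+ 2 = (tau b).[y] ^+ 2 - 4.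
  by rewrite sqr_sqrtr // subr_ge0; nra.
by rewrite /zeta; set t := (tau b).[y]; set s := Num.sqrt _ => es; field: es.
Qed.

(** Controls the distance of r zeta to its maximum 1, attained at y = 0. *)
Lemma zeta_factor y : y <= b ^+ 2 ->
  (1 - r * zeta y) * (1 - r / zeta y) = 4 * y / (1 + b) ^+ 2.
Proof.
move=> yb; have z1 := zeta_ge1 yb.
have z0 : zeta y != 0 by rewrite gt_eqF // (lt_le_trans _ z1).
have -> : (1 - r * zeta y) * (1 - r / zeta y) = 1 + r ^+ 2 - r * (zeta y + (zeta y)^-1).
  by field.
rewrite zetaDV // tauE /decay; field.
by rewrite !gt_eqF // ?subr_gt0.
Qed.

Lemma one_sub_div_zeta y : y <= b ^+ 2 -> 1 - r <= 1 - r / zeta y <= 1.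
Proof.
move=> yb; have z1 := zeta_ge1 yb; have z0 := lt_le_trans ltr01 z1.
rewrite lerD2l lerN2 ler_pdivrMr // ler_peMr ?(ltW r_gt0) //=.
by rewrite gerBl divr_ge0 // ltW.
Qed.

Lemma one_sub_decay_zeta y : 0 <= y <= b ^+ 2 ->
  4 * y / (1 + b) ^+ 2 <= 1 - r * zeta y <= 4 * y / (1 + b) ^+ 2 / (1 - r).
Proof.
move=> /andP[y0 yb]; have /andP[h1 h2] := one_sub_div_zeta yb.
have r1 : 0 < 1 - r by rewrite subr_gt0.
have := zeta_factor yb; set A := 4 * y / _ => e.
have A0 : 0 <= A by rewrite divr_ge0 ?sqr_ge0 // mulr_ge0.
have q0 : 0 <= 1 - r * zeta y.
  by rewrite -(pmulr_lge0 _ (lt_le_trans r1 h1)) e.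
rewrite ler_pdivlMr // -e; apply/andP; split.
  by rewrite ler_piMr.
by rewrite ler_wpM2l.
Qed.

(** V_(n+1) - zeta V_n is a geometric sequence of ratio 1/zeta, because the
    recurrence factors with roots zeta and 1/zeta. *)
Lemma chebV_geom n y : y <= b ^+ 2 ->
  (chebV b n.+1).[y] = zeta y * (chebV b n).[y] + ((zeta y)^-1 - r) / zeta y ^+ n.
Proof.
move=> yb; have z1 := zeta_ge1 yb.
have z0 : zeta y != 0 by rewrite gt_eqF // (lt_le_trans _ z1).
elim: n => [|n IH].
  by rewrite /= hornerD hornerN -zetaDV // !hornerE expr0 divr1; ring.
rewrite chebVSS hornerD hornerN hornerM -(zetaDV yb).
move: IH; set u := (chebV b n.+1).[y]; set v := (chebV b n).[y] => IH.
have -> : v = (u - ((zeta y)^-1 - r) / zeta y ^+ n) / zeta y by rewrite IH; field; rewrite z0 expf_neq0.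
by rewrite exprS; field; rewrite z0 expf_neq0.
Qed.

Lemma inv_zeta_ge y : 0 <= y <= b ^+ 2 -> 0 <= (zeta y)^-1 - r <= 1 - r * zeta y.
Proof.
move=> hy; have /andP[y0 yb] := hy.
have z1 := zeta_ge1 yb; have z0 := lt_le_trans ltr01 z1.
have /andP[q0 _] := one_sub_decay_zeta hy.
have q1 : 0 <= 1 - r * zeta y by apply: le_trans q0; rewrite divr_ge0 ?sqr_ge0 // mulr_ge0.
have -> : (zeta y)^-1 - r = (1 - r * zeta y) / zeta y by field; rewrite gt_eqF.
by rewrite divr_ge0 ?(ltW z0) //= ler_pdivrMr // ler_peMr.
Qed.

Lemma chebV_lower n y : 0 <= y <= b ^+ 2 -> zeta y ^+ n <= (chebV b n).[y].
Proof.
move=> hy; have /andP[y0 yb] := hy.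
have z0 := lt_le_trans ltr01 (zeta_ge1 yb).
have /andP[e0 _] := inv_zeta_ge hy.
elim: n => [|n IH]; first by rewrite expr0 hornerE.
rewrite chebV_geom // exprS -[X in X <= _]addr0 lerD ?ler_pM2l //.
by rewrite divr_ge0 // exprn_ge0 // ltW.
Qed.

(** Valid up to y = b^2, where zeta = 1; it serves for domination. *)
Lemma chebV_upper n y : 0 <= y <= b ^+ 2 ->
  (chebV b n).[y] <= zeta y ^+ n * (1 + n%:R * ((zeta y)^-1 - r)).
Proof.
move=> hy; have /andP[y0 yb] := hy.
have z1 := zeta_ge1 yb; have z0 := lt_le_trans ltr01 z1.
have /andP[e0 _] := inv_zeta_ge hy.
elim: n => [|n IH]; first by rewrite expr0 mul0r addr0 mulr1 hornerE.
rewrite chebV_geom //; set e := (zeta y)^-1 - r in e0 IH *.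
have -> : zeta y ^+ n.+1 * (1 + n.+1%:R * e) =
    zeta y * (zeta y ^+ n * (1 + n%:R * e)) + zeta y ^+ n.+1 * e.
  by rewrite exprS -natr1; ring.
apply: lerD; first by rewrite ler_pM2l.
rewrite mulrC ler_wpM2r //.
apply: (@le_trans _ _ 1); first by rewrite invf_le1 ?exprn_gt0 // exprn_ege1.
by rewrite exprn_ege1.
Qed.

(** Better for fixed zeta > 1, as its last factor does not grow with n; it serves
    for the pointwise limit. *)
Lemma chebV_upper_sharp n y : 0 <= y <= b ^+ 2 -> 1 < zeta y ->
  (chebV b n).[y] <= zeta y ^+ n * (1 + ((zeta y)^-1 - r) / (zeta y - 1)).
Proof.
move=> hy z1; have /andP[y0 yb] := hy.
have z0 := lt_trans ltr01 z1.
have /andP[e0 _] := inv_zeta_ge hy.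
have zm : 0 < zeta y - 1 by rewrite subr_gt0.
set e := (zeta y)^-1 - r in e0 *; set M := e / _.
have M0 : 0 <= M by rewrite divr_ge0 // ltW.
(* The stronger bound, with - M, is the one that is stable by the recurrence. *)
suff : (chebV b n).[y] <= zeta y ^+ n * (1 + M) - M.
  by move=> /le_trans; apply; rewrite gerBl.
elim: n => [|n IH]; first by rewrite expr0 mul1r addrK hornerE.
rewrite chebV_geom // -/e.
have : e / zeta y ^+ n <= e by rewrite ler_pdivrMr ?exprn_gt0 // ler_peMr // exprn_ege1 // ltW.
have -> : zeta y ^+ n.+1 * (1 + M) - M = zeta y * (zeta y ^+ n * (1 + M) - M) + e.
  by rewrite exprS /M; field; rewrite gt_eqF.
by move=> h; apply: lerD => //; rewrite ler_pM2l.
Qed.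

Definition kern n y := r ^+ n * (chebV b n).[y].

Lemma kern_ge0 n y : 0 <= y <= b ^+ 2 -> 0 <= kern n y.
Proof.
move=> hy; rewrite mulr_ge0 ?exprn_ge0 ?(ltW r_gt0) //.
apply: le_trans (chebV_lower n hy).
case/andP: hy => _ /zeta_ge1 z1.
by rewrite exprn_ge0 // (le_trans ler01).
Qed.

Lemma kern_lower n y : 0 <= y <= b ^+ 2 -> (r * zeta y) ^+ n <= kern n y.
Proof.
by move=> hy; rewrite exprMn ler_pM2l ?exprn_gt0 // chebV_lower.
Qed.

Lemma kern_upper_sharp n y : 0 <= y <= b ^+ 2 -> 1 < zeta y ->
  kern n y <= (r * zeta y) ^+ n * (1 + ((zeta y)^-1 - r) / (zeta y - 1)).
Proof.
by move=> hy z1; rewrite exprMn -mulrA ler_pM2l ?exprn_gt0 // chebV_upper_sharp.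
Qed.

(** From r zeta <= exp(-A) and 1/zeta - r <= A/(1-r), with A = 4y/(1+b)^2 >= y:
    the factor 1 + n A/(1-r) is absorbed by half of the exponential. *)
Lemma kern_gauss n y : 0 <= y <= b ^+ 2 ->
  kern n y <= 2 / (1 - r) * expR (- (n%:R * y / 2)).
Proof.
move=> hy; have /andP[y0 yb] := hy.
have z1 := zeta_ge1 yb; have z0 := lt_le_trans ltr01 z1.
have /andP[e0 e1] := inv_zeta_ge hy.
have /andP[q0 q1] := one_sub_decay_zeta hy.
have r1 : 0 < 1 - r by rewrite subr_gt0.
set A := 4 * y / _ in q0 q1.
have yA : y <= A.
  rewrite /A ler_pdivlMr ?exprn_gt0 // mulrC ler_wpM2r //.
  by have := b_gt0; have := b_lt1; rewrite expr2; nra.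
set q := r * zeta y in e1 q0 q1.
have hq0 : 0 < q by rewrite mulr_gt0.
have qe : q ^+ n <= expR (- (n%:R * A)).
  rewrite -mulrN expRM_natl; apply: lerXn2r; rewrite ?nnegrE ?expR_ge0 ?(ltW hq0) //.
  by apply: le_trans (expR_ge1Dx (- A)); lra.
set u := n%:R * A in qe.
have uy : n%:R * y <= u by rewrite ler_wpM2l.
have u0 : 0 <= u by rewrite mulr_ge0 // (le_trans y0).
apply: (@le_trans _ _ (expR (- u) * (2 / (1 - r) * expR (u / 2)))).
  apply: (@le_trans _ _ (q ^+ n * (1 + n%:R * ((zeta y)^-1 - r)))).
    by rewrite /q exprMn -mulrA ler_pM2l ?exprn_gt0 // chebV_upper.
  apply: ler_pM => //; first by rewrite exprn_ge0 // ltW.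
    by rewrite addr_ge0 // mulr_ge0.
  apply: (@le_trans _ _ (2 / (1 - r) * (1 + u / 2))); last first.
    by rewrite ler_pM2l ?divr_gt0 // expR_ge1Dx.
  have -> : 2 / (1 - r) * (1 + u / 2) = 2 / (1 - r) + n%:R * (A / (1 - r)).
    by rewrite /u; field; rewrite gt_eqF.
  apply: lerD; first by rewrite ler_pdivlMr //; have := r_gt0; lra.
  by rewrite ler_wpM2l // (le_trans e1).
rewrite mulrCA -expRD ler_pM2l ?divr_gt0 // ler_expR.
by move: uy; lra.
Qed.

End Growth.

(** * Limits and Gaussian integrals *)

Section Prelim.
Variable R : realType.

Lemma odd_index_gt0 n : 0 < (2 * n + 1)%:R :> R.
Proof. by rewrite ltr0n addn1. Qed.

Lemma cvg_inv_odd : (fun n => (2 * n + 1)%:R^-1 : R) @ \oo --> (0 : R).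
Proof.
apply: (squeeze_cvgr _ (cvg_cst (0 : R)) (@cvg_harmonic R)).
near=> n; rewrite invr_ge0 ler0n /= /harmonic lef_pV2 ?posrE ?odd_index_gt0 ?ltr0n //.
by rewrite ler_nat; lia.
Unshelve. all: by end_near. Qed.

(** The squeeze exp(-(1-q)/q) <= q <= exp(-(1-q)), raised to the power n. *)
Lemma cvg_expr_expR (q : nat -> R) (L : R) : (forall n, 0 < q n) ->
  q @ \oo --> (1 : R) -> (fun n => n%:R * (1 - q n)) @ \oo --> L ->
  (fun n => q n ^+ n) @ \oo --> expR (- L).
Proof.
move=> q0 q1 qL.
have H1 : (fun n => expR (- (n%:R * (1 - q n)))) @ \oo --> expR (- L).
  by apply: continuous_cvg; [exact: continuous_expR|exact: cvgN].
have H2 : (fun n => expR (- (n%:R * (1 - q n) * (q n)^-1))) @ \oo --> expR (- L).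
  apply: continuous_cvg; first exact: continuous_expR.
  apply: cvgN; rewrite -[X in _ --> X]mulr1 -[X in _ * X]invr1.
  by apply: cvgM => //; apply: cvgV => //; exact: oner_neq0.
apply: (squeeze_cvgr _ H2 H1).
near=> n; apply/andP; split.
  rewrite -mulrA -mulrN expRM_natl; apply: lerXn2r; rewrite ?nnegrE ?expR_ge0 ?(ltW (q0 n)) //.
  rewrite expRN -[X in _ <= X]invrK lef_pV2 ?posrE ?invr_gt0 ?expR_gt0 //.
  apply: le_trans (expR_ge1Dx _); rewrite le_eqVlt; apply/orP; left; apply/eqP.
  by field; rewrite gt_eqF.
rewrite -mulrN expRM_natl; apply: lerXn2r; rewrite ?nnegrE ?expR_ge0 ?(ltW (q0 n)) //.
by apply: le_trans (expR_ge1Dx _); lra.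
Unshelve. all: by end_near. Qed.

Lemma integral_normal_fun (sigma : R) : sigma != 0 ->
  (\int[lebesgue_measure]_x (normal_fun 0 sigma x)%:E = (Num.sqrt (sigma ^+ 2 * pi *+ 2))%:E)%E.
Proof.
move=> s0; have p0 := normal_peak_gt0 s0.
have -> : (fun x => (normal_fun 0 sigma x)%:E) =
    (fun x => ((normal_peak sigma)^-1)%:E * (normal_pdf 0 sigma x)%:E)%E.
  by apply/funext => x; rewrite normal_pdfE // -EFinM mulKf // gt_eqF.
rewrite integralZl //; last exact: integrable_normal_pdf.
by rewrite integral_normal_pdf mule1 /normal_peak invrK.
Qed.

Lemma integrable_normal_fun (k sigma : R) : sigma != 0 ->
  lebesgue_measure.-integrable setT (fun x => (k * normal_fun 0 sigma x)%:E).
Proof.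
move=> s0; have p0 := normal_peak_gt0 s0.
have -> : (fun x => (k * normal_fun 0 sigma x)%:E) =
    (fun x => (k * (normal_peak sigma)^-1)%:E * (normal_pdf 0 sigma x)%:E)%E.
  apply/funext => x; rewrite normal_pdfE // -EFinM; congr (_%:E).
  by field; rewrite gt_eqF.
by apply: integrableZl => //; exact: integrable_normal_pdf.
Qed.

End Prelim.

(** * Laplace's method *)

Section Laplace.
Variables (R : realType) (b : R).
Hypotheses (b_gt0 : 0 < b) (b_lt1 : b < 1).
Implicit Types (s w x y : R) (n : nat).

Local Notation r := (decay b).
Let b1_gt0 : 0 < 1 + b. Proof. by rewrite addr_gt0. Qed.
Let c_gt0 : 0 < 1 - b ^+ 2.
Proof. by rewrite subr_gt0 expr_lt1 // ltW. Qed.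
Let r_gt0 : 0 < r. Proof. exact: decay_gt0. Qed.
Let r_lt1 : r < 1. Proof. exact: decay_lt1. Qed.

Lemma cvg_zeta (y : nat -> R) : y @ \oo --> (0 : R) -> (fun n => zeta b (y n)) @ \oo --> r^-1.
Proof.
move=> y0.
have ht : (fun n => (tau b).[y n]) @ \oo --> r + r^-1.
  have -> : (fun n => (tau b).[y n]) = (fun n => r + r^-1 - 4 * y n / (1 - b ^+ 2)).
    by apply/funext => n; rewrite tauE.
  have e : r + r^-1 = r + r^-1 - 4 * 0 / (1 - b ^+ 2) by rewrite mulr0 mul0r subr0.
  rewrite [X in _ --> X]e.
  apply: cvgB; first exact: cvg_cst.
  by apply: cvgM; [apply: cvgM => //; exact: cvg_cst|exact: cvg_cst].
have hs : (fun n => Num.sqrt ((tau b).[y n] ^+ 2 - 4)) @ \oo --> r^-1 - r.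
  have -> : r^-1 - r = Num.sqrt ((r + r^-1) ^+ 2 - 4).
    have -> : (r + r^-1) ^+ 2 - 4 = (r^-1 - r) ^+ 2 by field; rewrite gt_eqF.
    rewrite sqrtr_sqr ger0_norm // subr_ge0 (le_trans (ltW r_lt1)) // invf_ge1 //; exact: ltW.
  apply: continuous_cvg; first exact: sqrt_continuous.
  apply: cvgB; last exact: cvg_cst.
  by under eq_fun do rewrite expr2; rewrite expr2; exact: cvgM.
rewrite /zeta.
have -> : r^-1 = ((r + r^-1) + (r^-1 - r)) / 2 by field; rewrite gt_eqF.
by apply: cvgM; [exact: cvgD|exact: cvg_cst].
Qed.

(** By [zeta_factor], n (1 - r zeta) equals
    (n/d) (4 s^2/(1+b)^2) / (1 - r/zeta), which tends to
    2 s^2 / ((1+b)^2 (1-r^2)) = s^2/(2b). *)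
Lemma cvg_kern s : (fun n => kern b n (s ^+ 2 / (2 * n + 1)%:R)) @ \oo
  --> normal_fun 0 (Num.sqrt b) s.
Proof.
set y := fun n => s ^+ 2 / (2 * n + 1)%:R.
have y0 : y @ \oo --> (0 : R).
  by rewrite -[X in _ --> X](mulr0 (s ^+ 2)); apply: cvgM; [exact: cvg_cst|exact: (@cvg_inv_odd R)].
have z0 := cvg_zeta y0.
have yge0 n : 0 <= y n by rewrite divr_ge0 ?sqr_ge0.
have rV1 : 1 < r^-1 by rewrite invf_gt1.
have ynear : \forall n \near \oo, y n <= b ^+ 2.
  by apply: (cvgr_le _ y0); rewrite exprn_gt0.
have znear : \forall n \near \oo, 1 < zeta b (y n) by apply: (cvgr_gt _ z0).
have rz : (fun n => r * zeta b (y n)) @ \oo --> (1 : R).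
  rewrite -[X in _ --> X](mulfV (lt0r_neq0 r_gt0)).
  by apply: cvgM => //; exact: cvg_cst.
have rdz : (fun n => 1 - r / zeta b (y n)) @ \oo --> 1 - r ^+ 2.
  apply: cvgB; first exact: cvg_cst.
  have -> : r ^+ 2 = r * (r^-1)^-1 by rewrite invrK expr2.
  apply: cvgM; first exact: cvg_cst.
  by apply: cvgV => //; rewrite invr_eq0 gt_eqF.
have r2 : 0 < 1 - r ^+ 2 by rewrite subr_gt0 expr_lt1 // ltW.
(* Off the range of the estimates, r zeta is replaced by 1 to keep it positive. *)
pose q n : R := if y n <= b ^+ 2 then r * zeta b (y n) else 1.
have q_near : \forall n \near \oo, r * zeta b (y n) = q n.
  by near=> n; rewrite /q ifT //; near: n.
have q_gt0 n : 0 < q n.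
  rewrite /q; case: ifP => // hy; rewrite mulr_gt0 //.
  exact: lt_le_trans (zeta_ge1 b_gt0 b_lt1 hy).
have q1 : q @ \oo --> (1 : R).
  by apply: cvg_trans rz; apply: near_eq_cvg.
have qL : (fun n => n%:R * (1 - q n)) @ \oo --> s ^+ 2 / (b * 2).
  have -> : s ^+ 2 / (b * 2) = (2^-1 - 2^-1 * 0) * (4 * s ^+ 2 / (1 + b) ^+ 2) * (1 - r ^+ 2)^-1.
    rewrite /decay; field.
    rewrite !gt_eqF //=.
    have -> : (1 + b) ^+ 2 - (1 - b) ^+ 2 = 4 * b by ring.
    by rewrite mulr_gt0.
  (* n / (2n + 1) = 1/2 - 1/2 * 1 / (2n + 1) *)
  apply: (@cvg_trans _ ((fun n => (2^-1 - 2^-1 * (2 * n + 1)%:R^-1) *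
    (4 * s ^+ 2 / (1 + b) ^+ 2) * (1 - r / zeta b (y n))^-1) @ \oo)).
    apply: near_eq_cvg; near=> n.
    have yb : y n <= b ^+ 2 by near: n.
    rewrite /q yb.
    have hd : 0 < 1 - r / zeta b (y n).
      have /andP[h _] := one_sub_div_zeta b_gt0 b_lt1 yb.
      by apply: lt_le_trans h; rewrite subr_gt0.
    have -> : 1 - r * zeta b (y n) = 4 * y n / (1 + b) ^+ 2 / (1 - r / zeta b (y n)).
      by rewrite -zeta_factor // mulfK // gt_eqF.
    move: hd; set D := 1 - r / _ => hd.
    have := odd_index_gt0 R n; rewrite /y natrD natrM => d0.
    by field; rewrite !gt_eqF.
  apply: cvgM; last by apply: cvgV => //; rewrite gt_eqF.
  apply: cvgM; last exact: cvg_cst.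
  apply: cvgB; first exact: cvg_cst.
  by apply: cvgM; [exact: cvg_cst|exact: (@cvg_inv_odd R)].
have qn := cvg_expr_expR q_gt0 q1 qL.
have -> : normal_fun 0 (Num.sqrt b) s = expR (- (s ^+ 2 / (b * 2))).
  by rewrite /normal_fun subr0 sqr_sqrtr ?(ltW b_gt0) // mulNr mulr_natr.
have e0 : (fun n => ((zeta b (y n))^-1 - r) / (zeta b (y n) - 1)) @ \oo --> (0 : R).
  rewrite -[X in _ --> X](mul0r (r^-1 - 1)^-1); apply: cvgM.
    have -> : 0 = (r^-1)^-1 - r by rewrite invrK subrr.
    apply: cvgB; last exact: cvg_cst.
    by apply: cvgV => //; rewrite invr_eq0 gt_eqF.
  apply: cvgV; first by rewrite gt_eqF // subr_gt0.
  by apply: cvgB => //; exact: cvg_cst.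
have up : (fun n => q n ^+ n * (1 + ((zeta b (y n))^-1 - r) / (zeta b (y n) - 1))) @ \oo
    --> expR (- (s ^+ 2 / (b * 2))).
  rewrite -[X in _ --> X]mulr1 -[X in _ * X]addr0; apply: cvgM => //.
  by apply: cvgD => //; exact: cvg_cst.
apply: (squeeze_cvgr _ qn up); near=> n.
have yb : y n <= b ^+ 2 by near: n.
have hy : 0 <= y n <= b ^+ 2 by rewrite yge0.
rewrite /q yb; apply/andP; split; first exact: kern_lower.
by apply: kern_upper_sharp => //; near: n.
Unshelve. all: by end_near. Qed.

Lemma continuous_kern n d : continuous (fun s => kern b n (s ^+ 2 / d)).
Proof.
move=> s; apply: cvgM; first exact: cvg_cst.
apply: (@continuous_comp _ _ _ (fun s => s ^+ 2 / d)); last exact: continuous_horner.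
by apply: cvgM; [exact: exprn_continuous|exact: cvg_cst].
Qed.

(** The substitution t = s / sqrt d in the integral of an even function. *)
Lemma integral_kern n :
  (\int[lebesgue_measure]_(s in `[(- (b * Num.sqrt (2 * n + 1)%:R))%R, (b * Num.sqrt (2 * n + 1)%:R)%R])
    (kern b n (s ^+ 2 / (2 * n + 1)%:R))%:E
  = (2 * (r ^+ n * Num.sqrt (2 * n + 1)%:R * (b * (odd_primitive (chebV b n)).[b ^+ 2])))%:E)%E.
Proof.
set d := (2 * n + 1)%:R; have d0 : 0 < d := odd_index_gt0 R n.
set c := Num.sqrt d; have c0 : 0 < c by rewrite sqrtr_gt0.
have ec : c ^+ 2 = d by rewrite sqr_sqrtr // ltW.
pose F s := r ^+ n * c * (s / c * (odd_primitive (chebV b n)).[(s / c) ^+ 2]).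
have dF s : is_derive s 1 F (kern b n (s ^+ 2 / d)).
  have d1 : is_derive s 1 (fun t : R => t / c) c^-1.
    by apply: is_derive_eq; rewrite -![_ *: _]/(_ * _); ring.
  have d2 := @is_derive1_comp R (fun t => t * (odd_primitive (chebV b n)).[t ^+ 2])
    (fun t => t / c) s _ _ (is_derive_odd_primitive (chebV b n) (s / c)) d1.
  apply: is_derive_eq.
  have es : (s / c) ^+ 2 = s ^+ 2 / d by rewrite expr_div_n ec.
  rewrite -![_ *: _]/(_ * _) /kern es.
  by field; rewrite gt_eqF.
have Bc : 0 < b * c by rewrite mulr_gt0.
have cF : continuous F.
  move=> s; apply: differentiable_continuous; apply/derivable1_diffP.
  by have [] := dF s.
rewrite (@continuous_FTC2 R (fun s : R => kern b n (s ^+ 2 / d)) F).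
- rewrite -EFinB /F mulrK ?unitfE ?gt_eqF // mulNr mulrK ?unitfE ?gt_eqF // sqrrN.
  by congr (_%:E); ring.
- by lra.
- by apply: continuous_subspaceT; exact: continuous_kern.
- split; first by move=> x _; have [] := dF x.
  + by apply: cvg_at_right_filter; exact: cF.
  + by apply: cvg_at_left_filter; exact: cF.
- by move=> x _; rewrite derive1E; have [_ ->] := dF x.
Qed.

(** Dominated convergence is applied to the terms n >= 1, because for n = 0 the
    bound of [kern_gauss] is constant, hence not integrable. *)
Lemma cvg_odd_primitive :
  (fun n => r ^+ n * Num.sqrt (2 * n + 1)%:R * (b * (odd_primitive (chebV b n)).[b ^+ 2]))
  @ \oo --> Num.sqrt (2 * pi * b) / 2.
Proof.
pose B n := b * Num.sqrt (2 * n + 1)%:R.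
pose f n (s : R) : \bar R :=
  (((fun s : R => kern b n.+1 (s ^+ 2 / (2 * n.+1 + 1)%:R)) \_ `[- B n.+1, B n.+1]) s)%:E.
have Bgt0 n : 0 < B n by rewrite mulr_gt0 // sqrtr_gt0 odd_index_gt0.
have inB n s : (s \in `[- B n, B n]) = (s ^+ 2 / (2 * n + 1)%:R <= b ^+ 2).
  rewrite in_itv /= -ler_norml ler_pdivrMr ?odd_index_gt0 //.
  rewrite -(@sqr_sqrtr _ (2 * n + 1)%:R) ?ler0n // -exprMn -real_normK ?num_real //.
  by rewrite ler_sqr ?nnegrE // ltW // Bgt0.
have fE n s : f n s = (if s ^+ 2 / (2 * n.+1 + 1)%:R <= b ^+ 2 then
   kern b n.+1 (s ^+ 2 / (2 * n.+1 + 1)%:R) else 0)%:E.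
  by rewrite /f patchE mem_setE inB; case: ifP.
have kge0 n s : 0 <= s ^+ 2 / (2 * n + 1)%:R by rewrite divr_ge0 ?sqr_ge0.
have sb0 : Num.sqrt b != 0 by rewrite gt_eqF // sqrtr_gt0.
(* The dominating Gaussian has deviation 2 because n / (2d) >= 1/8 for n >= 1. *)
have [|||||_ _] := @dominated_convergence _ _ R lebesgue_measure setT measurableT f
  (fun s => (normal_fun 0 (Num.sqrt b) s)%:E)
  (fun s => (2 / (1 - r) * normal_fun 0 2 s)%:E).
- move=> n; apply/measurable_EFinP; apply/(measurable_restrictT _ _).1 => //.
  apply: (@measurable_funS _ _ _ _ setT) => //.
  by apply: continuous_measurable_fun; exact: continuous_kern.
- by apply/measurable_EFinP; exact: measurable_normal_fun.
- apply: aeW => s _; under eq_fun do rewrite fE.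
  have ynear : \forall n \near \oo, s ^+ 2 / (2 * n.+1 + 1)%:R <= b ^+ 2.
    have : (fun n => s ^+ 2 / (2 * n + 1)%:R) @ \oo --> (0 : R).
      by rewrite -[X in _ --> X](mulr0 (s ^+ 2)); apply: cvgM; [exact: cvg_cst|exact: (@cvg_inv_odd R)].
    by rewrite -cvg_shiftS => /cvgr_le; apply; rewrite exprn_gt0.
  apply: cvg_EFin; first by near=> n.
  have := @cvg_kern s; rewrite -cvg_shiftS; apply: cvg_trans; apply: near_eq_cvg.
  by near=> n => /=; rewrite ifT //; near: n.
- exact: integrable_normal_fun.
- apply: aeW => s n _; rewrite fE lee_fin; case: ifP => h.
    have hy : 0 <= s ^+ 2 / (2 * n.+1 + 1)%:R <= b ^+ 2 by rewrite kge0.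
    rewrite ger0_norm ?kern_ge0 //; apply: le_trans (kern_gauss b_gt0 b_lt1 n.+1 hy) _.
    rewrite ler_pM2l ?divr_gt0 ?subr_gt0 // ler_expR subr0.
    rewrite mulNr lerN2 -(@mulr_natr _ (2 ^+ 2) 2).
    have -> : n.+1%:R * (s ^+ 2 / (2 * n.+1 + 1)%:R) / 2 = s ^+ 2 * (n.+1%:R / (2 * (2 * n.+1 + 1)%:R)).
      by have := odd_index_gt0 R n.+1; rewrite natrD natrM => ?; field; rewrite gt_eqF.
    rewrite ler_wpM2l ?sqr_ge0 // ler_pdivlMr ?mulr_gt0 ?odd_index_gt0 // natrD natrM.
    by have : 1 <= n.+1%:R :> R; [rewrite ler1n|lra].
  by rewrite normr0 mulr_ge0 ?normal_fun_ge0 ?divr_ge0 ?subr_ge0 // ltW.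
rewrite integral_normal_fun // => H.
rewrite -cvg_shiftS.
have {}H := fine_cvg H.
have -> : Num.sqrt (2 * pi * b) / 2 = 2^-1 * Num.sqrt (Num.sqrt b ^+ 2 * pi *+ 2).
  by rewrite sqr_sqrtr ?(ltW b_gt0) // mulrC -mulr_natl; congr (_ * Num.sqrt _); ring.
rewrite (_ : [sequence _]_n = fun n => 2^-1 * fine (\int[lebesgue_measure]_x f n x)%E); last first.
  apply/funext => n /=.
  have -> : f n = (EFin \o (fun s : R => kern b n.+1 (s ^+ 2 / (2 * n.+1 + 1)%:R)))
      \_ `[- B n.+1, B n.+1] by rewrite restrict_EFin.
  rewrite -integral_mkcond integral_kern [fine _]/=.
  by rewrite mulKf.
by apply: cvgM; [exact: cvg_cst|exact: H].
Unshelve. all: by end_near. Qed.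

End Laplace.

(** * The limits *)

Section Asymptotics.
Variables (R : realType) (b : R).
Hypotheses (b_gt0 : 0 < b) (b_lt1 : b < 1).
Implicit Types (n : nat).

Local Notation r := (decay b).
Local Notation d n := ((2 * n + 1)%:R : R).
Local Notation K := (4 * (b ^+ 3)^-1).

(** At w = 0 the parametrized point is b, so [residual_cst] and [norm_boundary]
    bound |u - W(b)| by O(1/d), while r^n sqrt d = o(d). *)
Lemma cvg_residual_pi : (fun n => r ^+ n * Num.sqrt (d n) * residual b n pi) @ \oo
  --> Num.sqrt (2 * pi * b) / 2.
Proof.
have K0 : 0 < K by rewrite divr_gt0 // exprn_gt0.
have bound n : `|residual b n pi - b * (odd_primitive (chebV b n)).[b ^+ 2]| <= (1 + K) / d n.
  have y0 : Num.sqrt (ysq b 0) = b.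
    rewrite /ysq cos0 (_ : _ - _ = b ^+ 2); last by field.
    by rewrite sqrtr_sqr gtr0_norm.
  have -> : residual b n pi - b * (odd_primitive (chebV b n)).[b ^+ 2] =
      (residual b n pi - residual b n 0) - boundary b n 0.
    by rewrite [residual b n 0]/residual y0; ring.
  have d1 : 1 <= d n by rewrite ler1n addn1.
  have d0 : 0 < d n := odd_index_gt0 R n.
  apply: le_trans (ler_normB _ _) _; rewrite mulrDl addrC; apply: lerD.
    apply: le_trans (norm_boundary b_gt0 b_lt1 n 0) _.
    by rewrite ler_pM2r ?invr_gt0 //; have := b_gt0; lra.
  apply: le_trans (residual_cst b_gt0 b_lt1 n _ _) _; rewrite ?lexx ?pi_ge0 //.
  rewrite ler_pM2l // lef_pV2 ?posrE ?exprn_gt0 // expr2.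
  by rewrite ler_peMr // ltW.
have sd : (fun n => (Num.sqrt (d n))^-1) @ \oo --> (0 : R).
  rewrite -[X in _ --> X](sqrtr0 R).
  rewrite (_ : (fun n => _) = fun n => Num.sqrt ((d n)^-1)); last first.
    by apply/funext => n; rewrite sqrtrV // ler0n.
  by apply: continuous_cvg; [exact: sqrt_continuous|exact: cvg_inv_odd].
have err : (fun n => r ^+ n * Num.sqrt (d n) *
    (residual b n pi - b * (odd_primitive (chebV b n)).[b ^+ 2])) @ \oo --> (0 : R).
  have up : (fun n => (1 + K) * (Num.sqrt (d n))^-1) @ \oo --> (0 : R).
    by rewrite -[X in _ --> X](mulr0 (1 + K)); apply: cvgM => //; exact: cvg_cst.
  apply/norm_cvg0P; apply: (squeeze_cvgr _ (cvg_cst (0 : R)) up).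
  near=> n; rewrite normr_ge0 /=.
  have d0 : 0 < d n := odd_index_gt0 R n.
  have s0 : 0 < Num.sqrt (d n) by rewrite sqrtr_gt0.
  have es : Num.sqrt (d n) ^+ 2 = d n by rewrite sqr_sqrtr // ltW.
  have r0 := decay_gt0 b_gt0 b_lt1.
  rewrite normrM gtr0_norm ?mulr_gt0 ?exprn_gt0 //.
  apply: (@le_trans _ _ (1 * Num.sqrt (d n) * ((1 + K) / d n))).
    apply: ler_pM => //; first by rewrite mulr_ge0 ?exprn_ge0 // ltW.
    rewrite ler_pM2r // exprn_ile1 // ltW //.
    exact: decay_lt1.
  rewrite mul1r -{2}es le_eqVlt; apply/orP; left; apply/eqP.
  by field; rewrite !gt_eqF.
rewrite -[X in _ --> X]addr0.
apply: cvg_trans (cvgD (cvg_odd_primitive b_gt0 b_lt1) err).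
apply: near_eq_cvg; near=> n.
by rewrite fctE -mulrDr addrC subrK.
Unshelve. all: by end_near. Qed.

(** The quotient of d |u| L --> 1 - b by the limit of r^n sqrt d u. *)
Lemma cvg_sgn_error0 :
  (fun n => sgn_error 0 n.+1 b * r^-1 ^+ n * Num.sqrt (d n)) @ \oo
  --> (1 - b) / (Num.sqrt (2 * pi * b) / 2).
Proof.
have l0 : 0 < Num.sqrt (2 * pi * b) / 2.
  by rewrite divr_gt0 // sqrtr_gt0 !mulr_gt0 // pi_gt0.
have T := cvg_residual_pi.
have r0 := decay_gt0 b_gt0 b_lt1.
have d0 n : 0 < d n := odd_index_gt0 R n.
have s0 n : 0 < Num.sqrt (d n) by rewrite sqrtr_gt0.
have unear : \forall n \near \oo, 0 < residual b n pi.
  have : \forall n \near \oo, 0 < r ^+ n * Num.sqrt (d n) * residual b n pi by apply: (cvgr_gt _ T).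
  apply: filterS => n; rewrite pmulr_rgt0 // mulr_gt0 // exprn_gt0 //.
have dV := @cvg_inv_odd R.
have lo : (fun n => (1 - b) * (1 + b^-1 * (d n)^-1)^-1 - K * (d n)^-1) @ \oo --> 1 - b.
  have e : 1 - b = (1 - b) * (1 + b^-1 * 0)^-1 - K * 0.
    by rewrite !mulr0 addr0 invr1 mulr1 subr0.
  rewrite [X in _ --> X]e.
  apply: cvgB; last by apply: cvgM => //; exact: cvg_cst.
  apply: cvgM; first exact: cvg_cst.
  apply: cvgV; first by rewrite mulr0 addr0 oner_neq0.
  apply: cvgD; first exact: cvg_cst.
  by apply: cvgM => //; exact: cvg_cst.
have hi : (fun n => (1 - b) + K * (d n)^-1) @ \oo --> 1 - b.
  have e : 1 - b = (1 - b) + K * 0 by rewrite mulr0 addr0.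
  rewrite [X in _ --> X]e.
  apply: cvgD; first exact: cvg_cst.
  by apply: cvgM => //; exact: cvg_cst.
have X : (fun n => d n * (`|residual b n pi| * sgn_error 0 n.+1 b)) @ \oo --> 1 - b.
  apply: (squeeze_cvgr _ lo hi); near=> n.
  have u0 : residual b n pi != 0 by rewrite gt_eqF //; near: n.
  have d1 := d0 n.
  have bi : 0 < b^-1 by rewrite invr_gt0.
  apply/andP; split.
    apply: le_trans (ler_wpM2l (ltW d1) (sgn_error_lower b_gt0 b_lt1 u0)).
    rewrite le_eqVlt; apply/orP; left; apply/eqP.
    have h1 : d n * b + 1 != 0 by rewrite gt_eqF // addr_gt0 // mulr_gt0.
    move: d1 h1; move: (d n) => D d1 h1.
    by field; rewrite h1 !gt_eqF.
  apply: le_trans (ler_wpM2l (ltW d1) (sgn_error_upper b_gt0 b_lt1 u0)) _.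
  rewrite le_eqVlt; apply/orP; left; apply/eqP.
  move: d1; move: (d n) => D d1.
  by field; rewrite !gt_eqF.
apply: cvg_trans (cvgM X (cvgV (lt0r_neq0 l0) T)).
apply: near_eq_cvg; near=> n.
have u0 : 0 < residual b n pi by near: n.
rewrite /= gtr0_norm // exprVn.
have es : Num.sqrt (d n) ^+ 2 = d n by rewrite sqr_sqrtr // ltW.
have rn0 : 0 < r ^+ n by rewrite exprn_gt0.
move: es u0 rn0 (s0 n); move: (Num.sqrt (d n)) (residual b n pi) (r ^+ n) => s u rn <- u0 rn0 s0'.
by field; rewrite !gt_eqF.
Unshelve. all: by end_near. Qed.

End Asymptotics.

Theorem mainTheorem6 (R : realType) :
  (forall (a : R) (m : nat), 0 < a -> a < 1 -> (0 < m)%N ->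
     sgn_error m m a = sgn_error 0 m (2 * Num.sqrt a / (1 + a))) /\
  (forall a : R, 0 < a -> a < 1 ->
     (fun m : nat =>
        sgn_error m m a
        * ((1 + Num.sqrt a) / (1 - Num.sqrt a)) ^+ (2 * m - 1)
        * Num.sqrt (2 * m - 1)%:R) @ \oo
     --> (1 - a) / Num.sqrt (pi * Num.sqrt a * (1 + a))).
Proof.
split; first by move=> a m; exact: sgn_error_joukowski.
move=> a a0 a1.
have sa : Num.sqrt a ^+ 2 = a by rewrite sqr_sqrtr // ltW.
have s0 : 0 < Num.sqrt a by rewrite sqrtr_gt0.
have s1 : Num.sqrt a < 1 by rewrite -(sqrtr1 R) ltr_sqrt.
set s := Num.sqrt a in sa s0 s1 *.
have p1 : 0 < 1 + a by rewrite addr_gt0.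
set b := 2 * s / (1 + a).
have b0 : 0 < b by rewrite divr_gt0 // mulr_gt0.
have b1 : b < 1.
  rewrite /b ltr_pdivrMr // mul1r -sa.
  by have : 0 < (1 - s) ^+ 2; [rewrite exprn_gt0 // subr_gt0|lra].
have h1 : 0 < 1 - s by rewrite subr_gt0.
have h2 : 0 < 1 + s by rewrite addr_gt0.
have rE : (decay b)^-1 = ((1 + s) / (1 - s)) ^+ 2.
  rewrite /decay /b -sa; field.
  have q2 : 1 + s ^+ 2 - 2 * s = (1 - s) ^+ 2 by ring.
  have q3 : 0 < 1 + s ^+ 2 by rewrite sa.
  have q4 : 0 < 1 + s ^+ 2 + 2 * s by rewrite addr_gt0 // mulr_gt0.
  by rewrite q2 (gt_eqF h1) (gt_eqF q3) (gt_eqF q4) gt_eqF ?exprn_gt0.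
have lE : (1 - a) / Num.sqrt (pi * s * (1 + a)) =
    (1 - b) / (Num.sqrt (2 * pi * b) / 2) * ((1 + s) / (1 - s)).
  have -> : Num.sqrt (2 * pi * b) / 2 = Num.sqrt (pi * s * (1 + a)) / (1 + a).
    have -> : 2 * pi * b = pi * s * (1 + a) * (2 / (1 + a)) ^+ 2.
      by rewrite /b; field; rewrite gt_eqF.
    rewrite sqrtrM ?mulr_ge0 ?pi_ge0 ?(ltW s0) ?(ltW p1) // sqrtr_sqr gtr0_norm ?divr_gt0 //.
    by field; rewrite gt_eqF.
  have q0 : 0 < Num.sqrt (pi * s * (1 + a)) by rewrite sqrtr_gt0 !mulr_gt0 // pi_gt0.
  move: q0; set q := Num.sqrt _ => q0; rewrite /b -sa; field.
  by rewrite (gt_eqF h1) (gt_eqF q0) sa gt_eqF.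
rewrite lE -cvg_shiftS.
apply: cvg_trans (cvgM (cvg_sgn_error0 b0 b1) (cvg_cst ((1 + s) / (1 - s)))).
apply: near_eq_cvg; near=> n.
rewrite /= sgn_error_joukowski // -/s -/b.
have -> : (2 * n.+1 - 1 = 2 * n + 1)%N by lia.
rewrite rE -exprM exprD expr1; ring.
Unshelve. all: by end_near. Qed.
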